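(* There does not exist $k\in\mathbb{Z}_{\ge 0}$ such that for every finite metric space $(X,\mathsf{d})$, $\|\mathrm{dgm}_1(\mathcal{F}_{(X,\mathsf{d})})\|$ belongs to $O(|X|^k)$, where $\mathcal{F}_{(X,\mathsf{d})}\in\{\mathrm{DRips}((X,\mathsf{d})),\ \mathrm{D}\check{\mathrm{C}}\mathrm{ech}((X,\mathsf{d}))\}$. That is, for each of the two constructions (Degree-Rips and Degree-Čech) separately, there are no $k\in\mathbb{Z}_{\ge 0}$ and constant $C>0$ such that $\|\mathrm{dgm}_1(\mathcal{F}_{(X,\mathsf{d})})\|\le C|X|^k$ for all $(X,\mathsf{d})$. (In the Čech case, $(X,\mathsf{d})$ ranges over finite subsets $X$ of $\mathbb{R}^D$, for arbitrary $D$ and an arbitrary metric on $\mathbb{R}^D$, with the restricted metric.)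
   Context: Fix a field $\mathbb{F}$. A poset $P$ is regarded as a category; a $P$-module is a functor $M:P\to\mathbf{vec}_{\mathbb{F}}$ to finite-dimensional $\mathbb{F}$-vector spaces. Complexes. For a metric space $(X,\mathsf{d})$ and $r\in\mathbb{R}_{\ge 0}$, the Vietoris–Rips complex is $\mathrm{Rips}((X,\mathsf{d}))_r=\{\text{finite }\sigma\subset X:\max_{x,y\in\sigma}\mathsf{d}(x,y)\le r\}$. If $X\subset\mathbb{R}^D$, where $\mathbb{R}^D$ carries a metric whose restriction to $X$ is $\mathsf{d}$, the Čech complex is $\check{\mathrm{C}}\mathrm{ech}((X,\mathsf{d}))_r=\{\text{finite }\sigma\subset X:\bigcap_{x\in\sigma}B_r(x)\ne\emptyset\}$, with $B_r(x)$ the closed ball of radius $r$ in $\mathbb{R}^D$ around $x$ for that metric. (Simplices are nonempty.) Bifiltrations. For $\delta\in\mathbb{Z}$ and $r\in\mathbb{R}_{\ge 0}$, $\mathrm{DRips}((X,\mathsf{d}))_{\delta,r}$ (resp. $\mathrm{D}\check{\mathrm{C}}\mathrm{ech}((X,\mathsf{d}))_{\delta,r}$) is the maximal subcomplex of $\mathrm{Rips}((X,\mathsf{d}))_r$ (resp. $\check{\mathrm{C}}\mathrm{ech}((X,\mathsf{d}))_r$) whose vertices have degree at least $\delta-1$ in the $1$-skeleton of $\mathrm{Rips}((X,\mathsf{d}))_r$ (resp. $\check{\mathrm{C}}\mathrm{ech}((X,\mathsf{d}))_r$). The Degree-Rips and Degree-Čech bifiltrations are the resulting families, indexed by the poset $\mathbb{Z}^{\mathrm{op}}\times\mathbb{R}_{\ge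 0}$ with product order, where $\mathbb{Z}^{\mathrm{op}}$ is $\mathbb{Z}$ with the reversed order. Intervals. An interval of a poset $P$ is a nonempty subset $I\subseteq P$ that is convex ($p,q\in I$, $p\le r\le q$ imply $r\in I$) and connected (any $p,q\in I$ are joined by a finite sequence in $I$ whose consecutive elements are comparable). $\mathrm{Int}(P)$ is the set of intervals of $P$. Generalized rank invariant. For a connected poset $P$ and a $P$-module $M$, with limit $(\varprojlim M,(\pi_p)_{p})$ and colimit $(\varinjlim M,(i_p)_{p})$, the map $\psi_M:=i_p\circ\pi_p:\varprojlim M\to\varinjlim M$ does not depend on $p\in P$; put $\mathrm{rank}(M):=\mathrm{rank}(\psi_M)$. The generalized rank invariant of a $P$-module $M$ is $\mathrm{rk}_M:\mathrm{Int}(P)\to\mathbb{Z}_{\ge 0}$, $I\mapsto\mathrm{rank}(M|_I)$. Generalized persistence diagram (GPD). The GPD of $M$ is the function $\mathrm{dgm}_M:\mathrm{Int}(P)\to\mathbb{Z}$ satisfying, for all $I\in\mathrm{Int}(P)$, $\mathrm{rk}_M(I)=\sum_{J\in\mathrm{Int}(P),\,J\supseteq I}\mathrm{dgm}_M(J)$, where the right-hand side has only finitely many nonzero summands. For a simplicial filtration $\mathcal{F}$ indexed by $P=\mathbb{Z}^{\mathrm{op}}\times\mathbb{R}_{\ge 0}$, $\mathrm{dgm}_1(\mathcal{F})$ is the GPD of the $P$-module $\mathrm{H}_1(\mathcal{F};\mathbb{F})$, and $\|\mathrm{dgm}_1(\mathcal{F})\|$ is the cardinality of its support $\{I\in\mathrm{Int}(P):\mathrm{dgm}_1(\mathcal{F})(I)\neq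 0\}$. The GPD is known to exist, to be unique and to be finitely supported when every simplex has finitely many birth indices (minimal elements of $P$ at which it is present, all later presence lying above one of them); the bound in the claim is understood to be required only of filtrations whose GPD exists. *)

(* Defs.v *)
From HB Require Import structures.
From mathcomp Require Import all_boot all_order all_algebra finmap.
From mathcomp Require Import generic_quotient ring_quotient.
From mathcomp Require Import boolp classical_sets functions cardinality fsbigop.
From mathcomp Require Import reals interval_inference.

Set Implicit Arguments.
Unset Strict Implicit.
Unset Printing Implicit Defensive.

Import Order.TTheory GRing.Theory Num.Theory.
Local Open Scope classical_set_scope.
Local Open Scope ring_scope.
Local Open Scope quotient_scope.

Record submodule (F : fieldType) (V : lmodType F) := Submodule {
  submodule_pred : V -> bool;
  submodule_closed : submod_closed submodule_pred }.

Section SubLmodule.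
Variables (F : fieldType) (V : lmodType F) (S : submodule V).

Record sublmod := SubLmod { sublmod_val : V; _ : sublmod_val \in submodule_pred S }.

HB.instance Definition _ := [isSub for sublmod_val].
HB.instance Definition _ := [Choice of sublmod by <:].
HB.instance Definition _ := GRing.SubChoice_isSubLmodule.Build F V
  (submodule_pred S) sublmod (submodule_closed S).

End SubLmodule.

Section QuotLmodule.
Variables (F : fieldType) (V : lmodType F) (S : submodule V).

Definition submodule_zmod : zmodClosed V :=
  HB.pack (submodule_pred S)
    (GRing.isSubmodClosed.Build F V (submodule_pred S) (submodule_closed S)).

Definition quotlmod := Quotient.quot submodule_zmod.
HB.instance Definition _ := GRing.Zmodule.on quotlmod.

Definition quot_pi (x : V) : quotlmod := \pi_(Quotient.quot submodule_zmod) x.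
Definition quot_repr (x : quotlmod) : V := repr (x : Quotient.quot submodule_zmod).

Lemma quot_reprK x : quot_pi (quot_repr x) = x.
Proof. exact: reprK. Qed.

Lemma quot_pi_eq x y : (quot_pi x == quot_pi y) = (x - y \in submodule_pred S).
Proof. exact: esym (Quotient.idealrBE submodule_zmod x y). Qed.

Lemma quot_piD x y : quot_pi (x + y) = quot_pi x + quot_pi y.
Proof. by rewrite /quot_pi raddfD. Qed.

Definition quot_scale (a : F) (x : quotlmod) : quotlmod :=
  quot_pi (a *: quot_repr x).

Lemma quot_scaleE a x : quot_scale a (quot_pi x) = quot_pi (a *: x).
Proof.
apply/eqP; rewrite quot_pi_eq -scalerBr.
have [S0 Slin] := submodule_closed S.
rewrite -[X in X \in _]addr0; apply: Slin => //.
by rewrite -quot_pi_eq quot_reprK.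
Qed.

Fact quot_scaleA a b x : quot_scale a (quot_scale b x) = quot_scale (a * b) x.
Proof. by rewrite -[x]quot_reprK !quot_scaleE scalerA. Qed.
Fact quot_scale1 : left_id 1 quot_scale.
Proof. by move=> x; rewrite -[x]quot_reprK !quot_scaleE scale1r. Qed.
Fact quot_scaleDr : right_distributive quot_scale +%R.
Proof.
move=> a x y; rewrite -[x]quot_reprK -[y]quot_reprK -quot_piD !quot_scaleE.
by rewrite scalerDr quot_piD.
Qed.
Fact quot_scaleDl x : {morph quot_scale^~ x : a b / a + b}.
Proof.
by move=> a b; rewrite -[x]quot_reprK !quot_scaleE scalerDl quot_piD.
Qed.

HB.instance Definition _ := GRing.Zmodule_isLmodule.Build F quotlmod
  quot_scaleA quot_scale1 quot_scaleDr quot_scaleDl.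

Lemma quot_pi_is_linear : linear quot_pi.
Proof. by move=> a x y; rewrite quot_piD -quot_scaleE. Qed.
HB.instance Definition _ := GRing.isLinear.Build F V quotlmod _ quot_pi
  quot_pi_is_linear.

End QuotLmodule.

Section QuotVect.
Variables (F : fieldType) (V : vectType F) (U : {vspace V}).

Definition vspace_submodule : submodule V := Submodule (memv_submod_closed U).

Definition quotv := quotlmod vspace_submodule.
HB.instance Definition _ := GRing.Lmodule.on quotv.

Definition quotv_pi : V -> quotv := @quot_pi F V vspace_submodule.
Definition quotv_repr : quotv -> V := @quot_repr F V vspace_submodule.
HB.instance Definition _ := GRing.Linear.copy quotv_pi (@quot_pi F V vspace_submodule).

Lemma quotv_piP a x y : quotv_pi (a *: x + y) = a *: quotv_pi x + quotv_pi y.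
Proof. exact: quot_pi_is_linear. Qed.

Lemma quotv_reprK x : quotv_pi (quotv_repr x) = x.
Proof. exact: quot_reprK. Qed.

Lemma quotv_pi_eq x y : (quotv_pi x == quotv_pi y) = (x - y \in U).
Proof. exact: quot_pi_eq. Qed.

Fact quotv_vect_iso : Vector.axiom (\dim (U^C)) quotv.
Proof.
pose W := (U^C)%VS; pose d : 'End(V) := daddv_pi W U.
have UW : (U :&: W = 0)%VS by rewrite capv_compl.
have WU : (W :&: U = 0)%VS by rewrite capvC.
have dE x : d x + daddv_pi U W x = x.
  by apply: daddv_pi_add WU _; rewrite addvC addv_complf memvf.
have dU x : x \in U -> d x = 0.
  move=> Ux; apply: (addIr (daddv_pi U W x)).
  by rewrite dE add0r daddv_pi_id.
have dB x : x - d x \in U by rewrite -{1}(dE x) addrAC subrr add0r memv_pi.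
pose g : V -> 'rV_(\dim W) := fun x => \row_i coord (vbasis W) i (d x).
have glin : linear g.
  by move=> a x y; apply/rowP=> i; rewrite !mxE linearP /= linearP.
have gU x y : x - y \in U -> g x = g y.
  move=> xyU; apply/rowP=> i; rewrite !mxE; congr (coord _ _ _).
  by rewrite -[x](subrK y) linearD /= (dU _ xyU) add0r.
have gpi x : g (quotv_repr (quotv_pi x)) = g x.
  by apply: gU; rewrite -quotv_pi_eq quotv_reprK.
exists (g \o quotv_repr).
  move=> a x y /=; rewrite -glin -[RHS]gpi; congr (g (quotv_repr _)).
  by rewrite quotv_piP !quotv_reprK.
exists (fun r : 'rV_(\dim W) => quotv_pi (\sum_i r 0 i *: (vbasis W)`_i)).
  move=> x /=; rewrite -[RHS]quotv_reprK; apply/eqP; rewrite quotv_pi_eq.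
  under eq_bigr do rewrite mxE.
  rewrite -coord_vbasis; last exact: memv_pi.
  by rewrite -opprB rpredN.
move=> r /=; rewrite gpi; apply/rowP=> i; rewrite mxE.
rewrite /d daddv_pi_id ?coord_sum_free ?(basis_free (vbasisP W)) //.
by apply: rpred_sum => j _; rewrite rpredZ ?vbasis_mem ?memt_nth.
Qed.

HB.instance Definition _ := Lmodule_hasFinDim.Build F quotv quotv_vect_iso.

End QuotVect.

(* [lmap_rank] is only meaningful when the range has finite dimension. *)
Section LinearRank.
Variables (F : fieldType) (V W : lmodType F) (f : V -> W).

Definition range_basis (n : nat) (e : 'I_n -> W) : Prop :=
  [/\ forall i, range f (e i),
      forall c : 'I_n -> F, \sum_i c i *: e i = 0 -> forall i, c i = 0
    & forall w, range f w -> exists c : 'I_n -> F, w = \sum_i c i *: e i].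

Definition lmap_rank : nat := xget 0%N [set n | exists e, @range_basis n e].

End LinearRank.

Section DProd.
Variables (F : fieldType) (T : Type) (M : T -> lmodType F).

Definition dprod := forall t, M t.
HB.instance Definition _ := gen_eqMixin dprod.
HB.instance Definition _ := gen_choiceMixin dprod.

Definition dprod_zero : dprod := fun=> 0.
Definition dprod_opp (x : dprod) : dprod := fun t => - x t.
Definition dprod_add (x y : dprod) : dprod := fun t => x t + y t.
Definition dprod_scale (a : F) (x : dprod) : dprod := fun t => a *: x t.

Fact dprod_addA : associative dprod_add.
Proof. by move=> x y z; apply: functional_extensionality_dep => t; exact: addrA. Qed.
Fact dprod_addC : commutative dprod_add.
Proof. by move=> x y; apply: functional_extensionality_dep => t; exact: addrC. Qed.
Fact dprod_add0 : left_id dprod_zero dprod_add.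
Proof. by move=> x; apply: functional_extensionality_dep => t; exact: add0r. Qed.
Fact dprod_addN : left_inverse dprod_zero dprod_opp dprod_add.
Proof. by move=> x; apply: functional_extensionality_dep => t; exact: addNr. Qed.
HB.instance Definition _ := GRing.isZmodule.Build dprod
  dprod_addA dprod_addC dprod_add0 dprod_addN.

Fact dprod_scaleA a b x : dprod_scale a (dprod_scale b x) = dprod_scale (a * b) x.
Proof. by apply: functional_extensionality_dep => t; exact: scalerA. Qed.
Fact dprod_scale1 : left_id 1 dprod_scale.
Proof. by move=> x; apply: functional_extensionality_dep => t; exact: scale1r. Qed.
Fact dprod_scaleDr : right_distributive dprod_scale +%R.
Proof. by move=> a x y; apply: functional_extensionality_dep => t; exact: scalerDr. Qed.
Fact dprod_scaleDl x : {morph dprod_scale^~ x : a b / a + b}.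
Proof. by move=> a b; apply: functional_extensionality_dep => t; exact: scalerDl. Qed.
HB.instance Definition _ := GRing.Zmodule_isLmodule.Build F dprod
  dprod_scaleA dprod_scale1 dprod_scaleDr dprod_scaleDl.

End DProd.

Record pmodule (F : fieldType) d (P : porderType d) := PModule {
  pm_obj :> P -> vectType F;
  pm_map : forall p q : P, (p <= q)%O -> 'Hom(pm_obj p, pm_obj q);
  pm_map_id : forall (p : P) (h : (p <= p)%O), pm_map h = \1%VF;
  pm_map_comp : forall (p q r : P) (h : (p <= q)%O) (k : (q <= r)%O)
    (l : (p <= r)%O), (pm_map k \o pm_map h)%VF = pm_map l }.

Section LimColim.
Variables (F : fieldType) (d : Order.disp_t) (P : porderType d).
Variable M : pmodule F P.

Local Notation prodM := (dprod (fun p : P => M p : lmodType F)).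

Definition limit_pred (x : prodM) : bool :=
  `[< forall (p q : P) (h : (p <= q)%O), pm_map M h (x p) = x q >].

Fact limit_submod_closed : submod_closed limit_pred.
Proof.
split; first by apply/asboolP => p q h; exact: linear0.
move=> a x y /asboolP hx /asboolP hy; apply/asboolP => p q h.
by rewrite -[RHS]/(a *: x q + y q) -(hx p q h) -(hy p q h) -linearP.
Qed.

Definition limit_submodule : submodule prodM := Submodule limit_submod_closed.

Definition limit := sublmod limit_submodule.

Definition limit_proj (p : P) (x : limit) : M p := sublmod_val x p.

Definition finsupp_pred (x : prodM) : bool :=
  `[< finite_set [set p | x p != 0] >].

Fact finsupp_submod_closed : submod_closed finsupp_pred.
Proof.
split.
  apply/asboolP; rewrite (_ : [set _ | _] = set0) //.
  by rewrite -subset0 => p /=; rewrite eqxx.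
move=> a x y /asboolP hx /asboolP hy; apply/asboolP.
apply: (@sub_finite_set _ _ ([set p | x p != 0] `|` [set p | y p != 0])).
  move=> p; apply: contraPP => /not_orP[/negP/negPn/eqP xp /negP/negPn/eqP yp].
  apply/negP/negPn; change (a *: x p + y p == 0).
  by rewrite xp yp scaler0 addr0.
by rewrite finite_setU.
Qed.

Definition finsupp_submodule : submodule prodM := Submodule finsupp_submod_closed.

Definition dsum := sublmod finsupp_submodule.

Definition dsum_single (p : P) (v : M p) : prodM :=
  dfwith (fun q => 0 : M q) v.

Fact dsum_single_finsupp p (v : M p) : dsum_single v \in finsupp_pred.
Proof.
apply/asboolP; apply: (@sub_finite_set _ _ [set p]); last exact: finite_set1.
move=> q /=; rewrite /dsum_single.
by case: dfwithP => // j _; rewrite eqxx.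
Qed.

Definition dsum_inj (p : P) (v : M p) : dsum :=
  @SubLmod _ _ finsupp_submodule _ (dsum_single_finsupp v).

(* The colimit is the quotient of the direct sum by the span of all
   [v - pm_map M h v]; the span is the smallest submodule containing them. *)
Definition colim_rel (x : dsum) : bool :=
  `[< forall S : {pred dsum}, submod_closed S ->
        (forall (p q : P) (h : (p <= q)%O) (v : M p),
           dsum_inj v - dsum_inj (pm_map M h v) \in S) ->
        x \in S >].

Fact colim_rel_submod_closed : submod_closed colim_rel.
Proof.
split; first by apply/asboolP => S [S0 _] _.
move=> a x y /asboolP hx /asboolP hy; apply/asboolP => S cS hS.
by have [_ Slin] := cS; apply: Slin; [exact: hx | exact: hy].
Qed.

Definition colim_rel_submodule : submodule dsum := Submodule colim_rel_submod_closed.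

Definition colimit := quotlmod colim_rel_submodule.

Definition colimit_inj (p : P) (v : M p) : colimit := quot_pi colim_rel_submodule (dsum_inj v).

Definition lim_to_colim (p : P) (x : limit) : colimit :=
  colimit_inj (limit_proj p x).

(* The rank of the canonical map from limit to colimit, which does not depend
   on [p] when [P] is connected. *)
Definition pmodule_rank (p : P) : nat := lmap_rank (lim_to_colim p).

End LimColim.

Section Subposet.
Variables (d : Order.disp_t) (P : porderType d) (I : set P).

Definition subposet := {p : P | p \in I}.
HB.instance Definition _ := SubChoice.on subposet.
HB.instance Definition _ := [SubChoice_isSubPOrder of subposet by <: with d].

End Subposet.

Section Restriction.
Variables (F : fieldType) (d : Order.disp_t) (P : porderType d).
Variables (M : pmodule F P) (I : set P).

Definition restrict_map (p q : subposet I) (h : (p <= q)%O) :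
  'Hom(M (val p), M (val q)) := pm_map M (h : (val p <= val q)%O).

Fact restrict_id p (h : (p <= p)%O) : @restrict_map p p h = \1%VF.
Proof. exact: pm_map_id. Qed.

Fact restrict_comp (p q r : subposet I) (h : (p <= q)%O) (k : (q <= r)%O)
    (l : (p <= r)%O) :
  (restrict_map k \o restrict_map h)%VF = restrict_map l.
Proof. exact: pm_map_comp. Qed.

Definition restrict : pmodule F (subposet I) :=
  @PModule F d (subposet I) (fun p => M (val p)) restrict_map
    restrict_id restrict_comp.

End Restriction.

Section Interval.
Variables (d : Order.disp_t) (P : porderType d).

Definition poset_convex (I : set P) : Prop :=
  forall p q r : P, I p -> I q -> (p <= r <= q)%O -> I r.

Definition poset_connected (I : set P) : Prop :=
  forall p q : P, I p -> I q -> exists s : seq P,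
    [/\ path (fun x y => (x >=< y)%O) p s, last p s = q
      & forall x, x \in s -> I x].

Record poset_interval := PosetInterval {
  interval_set :> set P;
  interval_neq0 : interval_set !=set0;
  interval_convex : poset_convex interval_set;
  interval_connected : poset_connected interval_set }.

HB.instance Definition _ := gen_eqMixin poset_interval.
HB.instance Definition _ := gen_choiceMixin poset_interval.

Fact interval_pt_subproof (I : poset_interval) : exists p : P, p \in interval_set I.
Proof. by have [p Ip] := interval_neq0 I; exists p; rewrite inE. Qed.

Definition interval_pt (I : poset_interval) : subposet I :=
  exist _ (xchoose (interval_pt_subproof I)) (xchooseP (interval_pt_subproof I)).

End Interval.

Section Diagram.
Variables (F : fieldType) (d : Order.disp_t) (P : porderType d).

Definition generalized_rank (M : pmodule F P) (I : poset_interval P) : nat :=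
  pmodule_rank (restrict M I) (interval_pt I).

(* [\sum_(J \in A) f J] is 0 by convention when the support is infinite, hence
   the first conjunct. *)
Definition is_gpd (M : pmodule F P) (dgm : poset_interval P -> int) : Prop :=
  forall I : poset_interval P,
    let above := [set J : poset_interval P | (I : set P) `<=` (J : set P)] in
    finite_set (above `&` [set J | dgm J != 0]) /\
    (generalized_rank M I)%:Z = \sum_(J \in above) dgm J.

Definition gpd_size_le (R : realType) (dgm : poset_interval P -> int) (x : R) : Prop :=
  exists n : nat, ([set J : poset_interval P | dgm J != 0] #= `I_n)%card /\ n%:R <= x.

End Diagram.

Section Complexes.
Variable V : finType.

Definition is_complex (K : {set {set V}}) : Prop :=
  (finset.set0 \notin K) /\
  (forall s t : {set V}, s \in K -> t \subset s -> t != finset.set0 -> t \in K).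

Record complex := Complex {
  simplices :> {set {set V}};
  complexP : is_complex simplices }.

End Complexes.

Section Homology.
Variables (F : fieldType) (V : finType).

(* Chains on all subsets of [V]; those of a complex form a subspace. A subset
   is oriented by the order that [enum_rank] puts on [V]. *)
Local Notation chain := {ffun {set V} -> F^o}.

Definition simplex_chain (s : {set V}) : chain := [ffun t => (t == s)%:R].

Definition vertex_position (s : {set V}) (v : V) : nat :=
  #|[set w in s | (enum_rank w < enum_rank v)%N]|.

Definition simplex_boundary (s : {set V}) : chain :=
  \sum_(v in s | (s :\ v)%SET != finset.set0)
    (-1) ^+ vertex_position s v *: simplex_chain ((s :\ v)%SET).

Definition boundary_fun (c : chain) : chain :=
  \sum_(s : {set V}) (c s : F) *: simplex_boundary s.

Fact boundary_fun_is_linear : linear boundary_fun.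
Proof.
move=> a x y; rewrite /boundary_fun scaler_sumr -big_split /=.
by apply: eq_bigr => s _; rewrite !ffunE scalerDl scalerA.
Qed.
HB.instance Definition _ := GRing.isLinear.Build F chain chain _ boundary_fun
  boundary_fun_is_linear.

Definition boundary : 'End(chain) := linfun boundary_fun.

Definition chains (n : nat) (K : complex V) : {vspace chain} :=
  <<[seq simplex_chain s | s : {set V} <- enum (simplices K) & #|s| == n.+1]>>%VS.

Definition cycles (n : nat) (K : complex V) : {vspace chain} :=
  (chains n K :&: lker boundary)%VS.

Definition boundaries (n : nat) (K : complex V) : {vspace chain} :=
  (boundary @: chains n.+1 K)%VS.

(* [vsval] is the inclusion of the cycles in the chains. *)
Definition homology (n : nat) (K : complex V) : vectType F :=
  quotv (linfun (vsval : subvs_of (cycles n K) -> chain)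
           @^-1: boundaries n K)%VS.

(* [[z] |-> [z]], to be used when [K \subset L]. *)
Definition homology_fun (n : nat) (K L : complex V) (x : homology n K) :
    homology n L :=
  quotv_pi _ (vsproj (cycles n L) (vsval (quotv_repr x))).

Definition homology_map (n : nat) (K L : complex V) :
  'Hom(homology n K, homology n L) := linfun (@homology_fun n K L).

Lemma chainsS n (K L : complex V) : K \subset L -> (chains n K <= chains n L)%VS.
Proof.
move=> /fintype.subsetP KL; apply: sub_span => c /mapP[s].
rewrite mem_filter mem_enum => /andP[sn sK] ->; apply/mapP; exists s => //.
by rewrite mem_filter mem_enum sn KL.
Qed.

Lemma cyclesS n (K L : complex V) : K \subset L -> (cycles n K <= cycles n L)%VS.
Proof. by move=> KL; rewrite capvS ?chainsS. Qed.

Lemma homology_funE n (K L : complex V) (KL : K \subset L)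
    (z : subvs_of (cycles n K)) :
  homology_fun L (quotv_pi _ z) = quotv_pi _ (vsproj (cycles n L) (vsval z)).
Proof.
apply/eqP; rewrite quotv_pi_eq -memv_preim lfunE /=.
have zL (u : subvs_of (cycles n K)) : vsval u \in cycles n L.
  exact: (subvP (cyclesS n KL)) (subvsP u).
rewrite !vsprojK //.
apply: (subvP (limgS _ (chainsS _ KL))).
pose B := (linfun (vsval : subvs_of (cycles n K) -> chain)
             @^-1: boundaries n K)%VS.
have : quotv_repr (quotv_pi B z) - z \in B.
  by rewrite -(quotv_pi_eq B) quotv_reprK eqxx.
by rewrite -memv_preim lfunE.
Qed.

Lemma homology_fun_is_linear n (K L : complex V) : K \subset L ->
  linear (@homology_fun n K L).
Proof.
move=> KL a x y; rewrite -[x]quotv_reprK -[y]quotv_reprK -linearP.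
by rewrite !homology_funE // !linearP.
Qed.

Lemma homology_mapE n (K L : complex V) (KL : K \subset L)
    (z : subvs_of (cycles n K)) :
  homology_map n K L (quotv_pi _ z) =
  quotv_pi _ (vsproj (cycles n L) (vsval z)).
Proof.
pose fM := GRing.isLinear.Build _ _ _ _ _ (@homology_fun_is_linear n K L KL).
pose f : {linear homology n K -> homology n L} := HB.pack (@homology_fun n K L) fM.
by rewrite -homology_funE // /homology_map (lfunE f).
Qed.

Lemma homology_map_id n (K : complex V) : homology_map n K K = \1%VF.
Proof.
apply/lfunP => x; rewrite -[x]quotv_reprK homology_mapE // vsvalK.
by rewrite id_lfunE.
Qed.

Lemma homology_map_comp n (K L N : complex V) : K \subset L -> L \subset N ->
  (homology_map n L N \o homology_map n K L)%VF = homology_map n K N.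
Proof.
move=> KL LN; apply/lfunP => x; rewrite -[x]quotv_reprK comp_lfunE.
rewrite !homology_mapE ?(fintype.subset_trans KL) //.
by rewrite vsprojK //; exact: (subvP (cyclesS n KL)) (subvsP _).
Qed.

End Homology.

Record filtration d (P : porderType d) (V : finType) := Filtration {
  filt_complex :> P -> complex V;
  filt_mono : forall p q : P, (p <= q)%O -> filt_complex p \subset filt_complex q }.

Section HomologyModule.
Variables (F : fieldType) (d : Order.disp_t) (P : porderType d) (V : finType).
Variables (n : nat) (K : filtration P V).

Fact homology_module_id (p : P) (h : (p <= p)%O) :
  homology_map F n (K p) (K p) = \1%VF.
Proof. exact: homology_map_id. Qed.

Fact homology_module_comp (p q r : P) (h : (p <= q)%O) (k : (q <= r)%O)
    (l : (p <= r)%O) :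
  (homology_map F n (K q) (K r) \o homology_map F n (K p) (K q))%VF =
  homology_map F n (K p) (K r).
Proof. by rewrite homology_map_comp ?filt_mono. Qed.

Definition homology_module : pmodule F P :=
  @PModule F d P (fun p => homology F n (K p))
    (fun p q _ => homology_map F n (K p) (K q))
    homology_module_id homology_module_comp.

End HomologyModule.

Section DegreeFiltration.
Variable V : finType.

Definition degree (K : {set {set V}}) (v : V) : nat :=
  #|[set e in K | (#|e| == 2%N) && (v \in e)]|.

Definition degree_ge_subcomplex (K : {set {set V}}) (m : int)
    (L : {set {set V}}) : Prop :=
  [/\ is_complex L, L \subset K
    & forall v : V, [set v]%SET \in L -> m - 1 <= (degree K v)%:Z].

(* The largest such subcomplex exists because they are closed under unions. *)
Definition degree_simplices (K : {set {set V}}) (m : int) : {set {set V}} :=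
  (\bigcup_(L : {set {set V}} | `[< degree_ge_subcomplex K m L >]) L)%SET.

Lemma degree_simplicesP (K : {set {set V}}) (m : int) :
  degree_ge_subcomplex K m (degree_simplices K m) /\
  forall L, degree_ge_subcomplex K m L -> L \subset degree_simplices K m.
Proof.
split; last first.
  move=> L hL; apply/fintype.subsetP => s sL; apply/bigcupP; exists L => //.
  exact/asboolP.
split; first split.
- apply/negP => /bigcupP[L /asboolP[[L0 _] _ _]].
  exact/negP.
- move=> s t /bigcupP[L hL sL] ts t0; apply/bigcupP; exists L => //.
  by case/asboolP: hL => -[_ +] _ _; apply; eassumption.
- by apply/bigcupsP => L /asboolP[].
- by move=> v /bigcupP[L /asboolP[_ _ +] vL]; apply.
Qed.

Definition degree_complex (K : complex V) (m : int) : complex V :=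
  Complex (let: And3 h _ _ := proj1 (degree_simplicesP K m) in h).

End DegreeFiltration.

Notation bidegree R := (int^d *p {nonneg R})%type.

Section DegreeBifiltration.
Variables (R : realType) (V : finType) (K : filtration {nonneg R} V).

Definition degree_bicomplex (p : bidegree R) : complex V :=
  degree_complex (K p.2) (p.1 : int).

Fact degree_bicomplex_mono (p q : bidegree R) :
  (p <= q)%O -> degree_bicomplex p \subset degree_bicomplex q.
Proof.
case: p q => m r [m' r'] /andP[/= mm' rr'].
have KK : K r \subset K r' by exact: filt_mono.
rewrite /degree_bicomplex /=.
apply: (proj2 (degree_simplicesP _ _)); have [[Lc LK Ldeg] _] :=
  degree_simplicesP (K r) m.
split=> //; first exact: fintype.subset_trans LK KK.
move=> v /Ldeg mv; have m'm : (m' : int) - 1 <= (m : int) - 1 by rewrite lerD2r.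
apply: (le_trans m'm); apply: (le_trans mv).
rewrite lez_nat subset_leq_card //; apply/fintype.subsetP => e.
by rewrite !inE => /andP[/(fintype.subsetP KK) -> ->].
Qed.

Definition degree_filtration : filtration (bidegree R) V :=
  Filtration degree_bicomplex_mono.

End DegreeBifiltration.

Definition is_metric (R : realType) (T : Type) (dist : T -> T -> R) : Prop :=
  [/\ forall x y, 0 <= dist x y,
      forall x y, dist x y = 0 <-> x = y,
      forall x y, dist x y = dist y x
    & forall x y z, dist x z <= dist x y + dist y z].

Section Rips.
Variables (R : realType) (X : finType) (dist : X -> X -> R).

Definition rips_simplices (r : {nonneg R}) : {set {set X}} :=
  [set s : {set X} | (s != finset.set0) &&
    [forall x in s, forall y in s, dist x y <= r%:num]]%SET.

Fact rips_is_complex r : is_complex (rips_simplices r).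
Proof.
split=> [|s t]; rewrite !inE ?eqxx // => /andP[_ /forall_inP sr] /fintype.subsetP ts ->.
apply/forall_inP => x /ts /sr /forall_inP h.
by apply/forall_inP => y /ts /h.
Qed.

Definition rips_complex r : complex X := Complex (rips_is_complex r).

Fact rips_mono (r r' : {nonneg R}) :
  (r <= r')%O -> rips_complex r \subset rips_complex r'.
Proof.
move=> rr; apply/fintype.subsetP => s; rewrite !inE => /andP[-> /forall_inP sr] /=.
apply/forall_inP => x /sr /forall_inP h.
by apply/forall_inP => y /h /le_trans; apply.
Qed.

Definition rips : filtration {nonneg R} X := Filtration rips_mono.

Definition degree_rips : filtration (bidegree R) X := degree_filtration rips.

End Rips.

Section Cech.
Variables (R : realType) (D : nat) (dist : 'rV[R]_D -> 'rV[R]_D -> R).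
Variable X : {fset 'rV[R]_D}.

(* Not [closed_ball]: [dist] need not come from the norm of ['rV[R]_D]. *)
Definition dist_closed_ball (x : 'rV[R]_D) (r : R) : set 'rV[R]_D :=
  [set z | dist x z <= r].

Definition cech_simplices (r : {nonneg R}) : {set {set X}} :=
  [set s : {set X} | (s != finset.set0) &&
    `[< \bigcap_(x in [set x : X | x \in s])
          dist_closed_ball (val x) r%:num !=set0 >] ]%SET.

Fact cech_is_complex r : is_complex (cech_simplices r).
Proof.
split=> [|s t]; rewrite !inE ?eqxx // => /andP[_ /asboolP[z sz]] /fintype.subsetP ts ->.
by apply/asboolP; exists z => x /= /ts; exact: sz.
Qed.

Definition cech_complex r : complex X := Complex (cech_is_complex r).

Fact cech_mono (r r' : {nonneg R}) :
  (r <= r')%O -> cech_complex r \subset cech_complex r'.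
Proof.
move=> rr; apply/fintype.subsetP => s; rewrite !inE => /andP[-> /asboolP[z sz]] /=.
by apply/asboolP; exists z => x /= /sz /le_trans; apply.
Qed.

Definition cech : filtration {nonneg R} X := Filtration cech_mono.

Definition degree_cech : filtration (bidegree R) X := degree_filtration cech.

End Cech.

(* Main.v *)
Require Import Defs.
From HB Require Import structures.
From mathcomp Require Import all_boot all_order all_algebra finmap.
From mathcomp Require Import boolp classical_sets functions cardinality fsbigop.
From mathcomp Require Import reals interval_inference.
From mathcomp Require Import zify ring.

(** The dimensions of the homology are polynomial in the number of points, so a
    diagram with exponentially many elements has to owe them to cancellation
    between positive and negative ones.  Its source here is the theta graph:
    two poles and [n] middle vertices, each joined to both poles.  A
    [1]-cycle assigns to each middle vertex the flow through it, and the flows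
    add up to [0].  If only the middle vertices in a set [S] are present, the
    cycle space has dimension [|S| - 1], or [0] when [S] is empty.  Since
    [|S| - 1 + (S is empty)] is the sum of [(-1) ^ |A|] over all subsets [A] of
    [S] with at least two elements ([sum_large_subsets_sign]), Moebius
    inversion over the subsets produces a nonzero coefficient for exponentially
    many [A].

    The graph is weighted, and leaves are hung on its vertices, so that on the
    bidegrees of radius [r < 2] the degree filtration consists of graphs
    without triangles.  There the homology module is a diagram of cycle spaces
    and inclusions.  Over an interval [I] a section of such a diagram is one
    cycle common to all complexes, and it survives in the colimit because all
    the cycle spaces embed in the chains; so the generalized rank is the
    dimension of the common cycle space ([theta_generalized_rank]), that is
    [|S| - 1] truncated at [0], where [S] is the set of middle vertices joined
    to both poles throughout [I].  At radius [r >= 2] all complexes are full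
    simplices or empty, the homology vanishes, and the rank of an interval that
    reaches this region is [0].  Hence, for every interval [I], the rank is the
    sum of [(-1) ^ |A|] over the [A] with at least two elements such that [I]
    is included in the convex set [Q A] of the bidegrees of radius less than
    [2] where all middle vertices of [A] are joined to both poles.

    An interval included in [Q A] lies in exactly one connected component of
    [Q A], and these components are intervals.  Counting components with the
    weights [(-1) ^ |A|] therefore gives a diagram ([component_gpdP]).  All the
    [Q A] contain a common bidegree, the apex; their components through the
    apex are pairwise distinct, because below the apex there are incomparable
    bidegrees, the corners, such that the [i]-th corner misses exactly the
    [i]-th middle vertex.  So the [2 ^ n - n - 1] sets [A] contribute distinct
    elements of the support ([component_gpd_size]), while the metric space has
    [(n + 2) * (n + 1)] points.

    The Cech case reduces to the same filtration: a finite metric with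
    distances in [[1, 2]] can be placed in the line, with an ambient metric
    that puts distinct points of the space at distance [2] and adds for every
    set of points a witness at distance the diameter of this set
    ([rips_as_cech]).  The Cech complexes of the image are then the Rips
    complexes of the original metric. *)

Set Implicit Arguments.
Unset Strict Implicit.
Unset Printing Implicit Defensive.

Import Order.TTheory GRing.Theory Num.Theory.
Local Open Scope ring_scope.

(** * Generalized rank of a module of inclusions *)

Section Rank.
Local Open Scope classical_set_scope.

(** Writing two bases in terms of each other gives two matrices with product
    the identity; the target space itself may have infinite dimension. *)
Lemma range_basis_le (F : fieldType) (V W : lmodType F) (f : V -> W)
    n (e : 'I_n -> W) m (e' : 'I_m -> W) :
  range_basis f e -> range_basis f e' -> (m <= n)%N.
Proof.
move=> [fe free_e span_e] [fe' free_e' span_e'].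
have /choice[A Ae'] : forall j, exists c : 'I_n -> F, e' j = \sum_i c i *: e i.
  by move=> j; exact: span_e.
have /choice[B Be] : forall i, exists c : 'I_m -> F, e i = \sum_j c j *: e' j.
  by move=> i; exact: span_e'.
pose MA := \matrix_(j, i) A j i; pose MB := \matrix_(i, j) B i j.
apply: (@mulmx1_min _ _ _ MA MB); apply/matrixP => j k.
apply/eqP; rewrite -subr_eq0; apply/eqP.
apply: (free_e' (fun k => (MA *m MB) j k - 1%:M j k)).
under eq_bigr do rewrite scalerBl.
rewrite sumrB; apply/eqP; rewrite subr_eq0; apply/eqP; symmetry.
transitivity (e' j).
  rewrite (bigD1 j)//= big1 ?addr0; first by rewrite mxE eqxx scale1r.
  by move=> i /negPf ij; rewrite mxE eq_sym ij scale0r.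
rewrite [LHS]Ae'.
under eq_bigr do rewrite Be scaler_sumr.
rewrite exchange_big/=; apply: eq_bigr => i _.
rewrite mxE scaler_suml; apply: eq_bigr => l _.
by rewrite !mxE scalerA.
Qed.

Lemma lmap_rank_eq (F : fieldType) (V W : lmodType F) (f : V -> W)
    n (e : 'I_n -> W) : range_basis f e -> lmap_rank f = n.
Proof.
move=> be; rewrite /lmap_rank.
case: xgetP => [m -> [e' be']|/(_ n)[]]; last by exists e.
by apply/eqP; rewrite eqn_leq (range_basis_le be be') (range_basis_le be' be).
Qed.

(** Connectedness of an interval as an induction principle. *)
Lemma interval_connected_ind d (P : porderType d) (I : poset_interval P)
    (Phi : subposet I -> Prop) :
  (forall p q : subposet I, (p <= q)%O -> Phi p <-> Phi q) ->
  forall p q, Phi p -> Phi q.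
Proof.
move=> step p q; have := @interval_connected _ _ I (val p) (val q).
have /set_mem Ip := valP p; have /set_mem Iq := valP q.
move=> /(_ Ip Iq)[s [+ + +]].
elim: s p Ip => [|x s IH] p Ip /=.
  by move=> _ /val_inj ->.
move=> /andP[px xs] lq sI Pp.
have Ix : x \in (I : set P) by rewrite inE; apply: sI; rewrite inE eqxx.
pose x' : subposet I := exist _ x Ix.
apply: (IH x') => //=.
- by apply: sI; rewrite inE eqxx.
- by move=> y ys; apply: sI; rewrite inE ys orbT.
have [px'|xp] := orP px.
- exact: (proj1 (step p x' px')).
- exact: (proj2 (step x' p xp)).
Qed.

(** For maps that are linear without carrying a structure of linear map. *)
Lemma lin_sum (F : fieldType) (V W : lmodType F) (g : V -> W) : linear g ->
  forall m (c : 'I_m -> F) (v : 'I_m -> V),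
    g (\sum_i c i *: v i) = \sum_i c i *: g (v i).
Proof.
move=> g_lin m c v.
pose gM := GRing.isLinear.Build _ _ _ _ _ g_lin.
pose G : {linear V -> W} := HB.pack g gM.
rewrite -[g]/(G : V -> W) linear_sum; apply: eq_bigr => i _.
by rewrite linearZ_LR.
Qed.

Section Colimit.
Variables (F : fieldType) (d : Order.disp_t) (P : porderType d).
Variables (N : pmodule F P).

Lemma colimit_inj_map p q (h : (p <= q)%O) (v : N p) :
  colimit_inj v = colimit_inj (pm_map N h v).
Proof.
apply/eqP; rewrite quot_pi_eq; apply/asboolP => S _; exact.
Qed.

Lemma dsum_inj_linear p a (u v : N p) :
  dsum_inj (a *: u + v) = a *: dsum_inj u + dsum_inj v.
Proof.
apply: val_inj; apply: functional_extensionality_dep => q /=.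
rewrite -[RHS]/(a *: (dsum_single u q) + dsum_single v q) /dsum_single.
have [?|pq] := eqVneq p q; first by subst q; rewrite !dfwith_in.
by rewrite !dfwith_out// scaler0 addr0.
Qed.

Lemma colimit_inj_linear p : linear (@colimit_inj F d P N p).
Proof. by move=> a u v; rewrite /colimit_inj dsum_inj_linear linearP. Qed.

Variables (W : lmodType F) (h : forall p, N p -> W).
Hypothesis h_lin : forall p, linear (@h p).
Hypothesis h_nat : forall p q (pq : (p <= q)%O) (v : N p),
  h (pm_map N pq v) = h v.

Let h0 p : h (0 : N p) = 0.
Proof.
by have := h_lin (-1) (0 : N p) 0; rewrite scaler0 addr0 scaleN1r addNr.
Qed.

(* The map out of the direct sum induced by [h]; its kernel is a submodule that
   contains the relations defining the colimit. *)
Let dsum_desc (x : dsum N) : W := \sum_(p \in [set: P]) h (sublmod_val x p).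

Let dsum_desc_linear : linear dsum_desc.
Proof.
move=> a x y; rewrite /dsum_desc.
have /asboolP fx := valP x; have /asboolP fy := valP y.
pose A := fset_set ([set p | sublmod_val x p != 0] `|` [set p | sublmod_val y p != 0]).
have AP i : i \notin A -> sublmod_val x i = 0 /\ sublmod_val y i = 0.
  rewrite in_fset_set ?finite_setU// notin_setE => /not_orP[/= /negP].
  by rewrite negbK => /eqP -> /negP; rewrite negbK => /eqP ->.
have on_A (z : dsum N) : (forall i, i \notin A -> sublmod_val z i = 0) ->
    \sum_(p \in [set: P]) h (sublmod_val z p) = \sum_(p <- A) h (sublmod_val z p).
  by move=> z0; apply: fsbigTE => i /z0 ->; exact: h0.
rewrite !on_A; last first.
- move=> i /AP[xi yi].
  change (a *: sublmod_val x i + sublmod_val y i = 0).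
  by rewrite xi yi scaler0 addr0.
- by move=> i /AP[].
- by move=> i /AP[].
by rewrite scaler_sumr -big_split/=; apply: eq_bigr => i _; rewrite -h_lin.
Qed.

Let dsum_desc_inj p (v : N p) : dsum_desc (dsum_inj v) = h v.
Proof.
rewrite /dsum_desc (@fsbigTE _ _ _ _ [fset p]%fset).
  by rewrite big_seq_fset1 /= /dsum_single dfwith_in.
move=> i; rewrite inE => ip.
by rewrite /= /dsum_single dfwith_out ?h0// eq_sym.
Qed.

(** This is the universal property of the colimit: the natural family [h]
    factors through it, so it detects nonzero classes. *)
Lemma colimit_inj_eq0 p (v : N p) : colimit_inj v = 0 -> h v = 0.
Proof.
move=> /eqP; rewrite -[0 in X in X -> _](linear0 (quot_pi (colim_rel_submodule N))).
rewrite quot_pi_eq subr0 => /asboolP /(_ [pred x | dsum_desc x == 0]).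
rewrite -dsum_desc_inj => H; apply/eqP; apply: H.
  split; first by have := dsum_desc_linear (-1) 0 0;
    rewrite inE scaler0 addr0 scaleN1r addNr => ->.
  move=> a x y; rewrite !inE => /eqP x0 /eqP y0.
  by rewrite dsum_desc_linear x0 y0 scaler0 addr0.
move=> q r qr w; rewrite inE addrC -scaleN1r dsum_desc_linear !dsum_desc_inj.
by rewrite h_nat scaleN1r addNr.
Qed.

End Colimit.

Section RestrictedRank.
Variables (F : fieldType) (d : Order.disp_t) (P : porderType d).
Variables (M : pmodule F P) (I : poset_interval P).

(** The values of a section at comparable elements are identified in the
    colimit, and an interval is connected. *)
Lemma lim_to_colim_irrel (p q : subposet I) (x : limit (Defs.restrict M I)) :
  lim_to_colim p x = lim_to_colim q x.
Proof.
pose Phi q := lim_to_colim p x = lim_to_colim q x.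
apply: (interval_connected_ind (Phi := Phi) _ (p := p)) => // p' q' le.
suff -> : Phi p' = Phi q' by [].
congr (_ = _); have /asboolP x_compat := valP x.
by rewrite /lim_to_colim (colimit_inj_map le) /limit_proj x_compat.
Qed.

Lemma generalized_rank_eq0 (p : P) :
  interval_set I p -> (forall v : M p, v = 0) -> generalized_rank M I = 0%N.
Proof.
move=> Ip Mp0; have Ip' : p \in (I : set P) by rewrite inE.
pose e (i : 'I_0) : colimit (Defs.restrict M I) := 0.
apply: (lmap_rank_eq (e := e)); split=> [[]//|c _ []//|].
move=> _ [x _ <-]; exists (fun=> 0); rewrite big_ord0.
rewrite (lim_to_colim_irrel _ (exist _ p Ip')) /lim_to_colim.
have -> : limit_proj (exist _ p Ip' : subposet I) x = 0 by exact: Mp0.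
by rewrite /colimit_inj -[RHS](linear0 (quot_pi _)); congr (quot_pi _ _);
  apply: val_inj; apply: functional_extensionality_dep => q /=;
  rewrite /dsum_single; case: dfwithP.
Qed.

Variables (W : lmodType F) (h : forall p, M p -> W).
Hypothesis h_lin : forall p, interval_set I p -> linear (@h p).
Hypothesis h_inj : forall p, interval_set I p -> forall v : M p, h v = 0 -> v = 0.
Hypothesis h_nat : forall p q (pq : (p <= q)%O) (v : M p),
  interval_set I p -> interval_set I q ->
  h (pm_map M pq v) = h v.

(** When the module embeds in one space [W] by maps [h] compatible with its
    structure maps, connectedness makes a section constant as an element of
    [W]: sections are the elements of [W] in all the images.  None of them dies
    in the colimit, which [h] maps to [W].  So the rank is the dimension of the
    intersection of the images, given here by the basis [u]. *)
Lemma generalized_rank_inclusions m (u : 'I_m -> W) :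
  (forall i p, interval_set I p -> exists v : M p, h v = u i) ->
  (forall c : 'I_m -> F, \sum_i c i *: u i = 0 -> forall i, c i = 0) ->
  (forall w, (forall p, interval_set I p -> exists v : M p, h v = w) ->
     exists c : 'I_m -> F, w = \sum_i c i *: u i) ->
  generalized_rank M I = m.
Proof.
move=> u_lift u_free u_span.
pose N := Defs.restrict M I; pose h' (p : subposet I) (v : N p) : W := h v.
have IP (p : subposet I) : interval_set I (val p) by have /set_mem := valP p.
have h'_lin p : linear (@h' p) by exact: h_lin.
have h'_nat p q (pq : (p <= q)%O) (v : N p) : h' _ (pm_map N pq v) = h' _ v.
  exact: h_nat.
have h'_inj p (v w : N p) : h' _ v = h' _ w -> v = w.
  move=> vw; apply/eqP; rewrite -subr_eq0; apply/eqP; apply: (h_inj (IP p)).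
  have := h'_lin p (-1) w v; rewrite !scaleN1r [- w + v]addrC /h' => ->.
  by rewrite -/(h' p v) vw addNr.
have section (w : W) : (forall p, interval_set I p -> exists v : M p, h v = w) ->
    exists x : limit N, forall p, h' p (limit_proj p x) = w.
  move=> wI.
  pose x (p : subposet I) : N p := projT1 (cid (wI (val p) (IP p))).
  have xw p : h' p (x p) = w := projT2 (cid (wI (val p) (IP p))).
  have x_lim : (x : dprod (fun p => N p : lmodType F)) \in limit_pred (M := N).
    by apply/asboolP => p q pq; apply: h'_inj; rewrite h'_nat !xw.
  by exists (@SubLmod _ _ (limit_submodule N) _ x_lim).
have /choice[x xu] : forall i, exists x : limit N, forall p, h' p (limit_proj p x) = u i.
  by move=> i; apply: section; exact: u_lift.
pose p0 := interval_pt I.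
pose e i := lim_to_colim p0 (x i).
have sumE (c : 'I_m -> F) : exists v : N p0,
    h' _ v = \sum_i c i *: u i /\ colimit_inj v = \sum_i c i *: e i.
  exists (\sum_i c i *: limit_proj p0 (x i)).
  rewrite (lin_sum (h'_lin p0)) (lin_sum (@colimit_inj_linear _ _ _ N p0)).
  by split=> //; apply: eq_bigr => i _; rewrite xu.
apply: (lmap_rank_eq (e := e)); split.
- by move=> i; exists (x i).
- move=> c; have [v [vu <-]] := sumE c => v0 i; apply: u_free.
  by rewrite -vu; apply: colimit_inj_eq0 v0.
move=> _ [y _ <-].
have [c yc] : exists c : 'I_m -> F, h' p0 (limit_proj p0 y) = \sum_i c i *: u i.
  apply: u_span => p Ip.
  have Ip' : p \in (I : set P) by rewrite inE.
  pose p' : subposet I := exist _ p Ip'.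
  exists (limit_proj p' y); rewrite -/(h' p' _).
  pose Phi q := h' q (limit_proj q y) = h' p0 (limit_proj p0 y).
  apply: (interval_connected_ind (Phi := Phi) _ (p := p0)) => //.
  move=> q r qr; rewrite /Phi.
  have /asboolP y_compat := valP y.
  by rewrite /limit_proj -(y_compat q r qr) h'_nat.
exists c; have [v [vu <-]] := sumE c; rewrite /lim_to_colim.
by congr colimit_inj; apply: h'_inj; rewrite vu yc.
Qed.

End RestrictedRank.

End Rank.

(** * Connected components and diagrams *)

Section Components.
Local Open Scope classical_set_scope.
Variables (d : Order.disp_t) (P : porderType d).
Implicit Types (Q S : set P) (p q : P) (I J : poset_interval P).

Lemma poset_interval_inj I J : interval_set I = interval_set J -> I = J.
Proof.
case: I J => [I I0 Ic Ico] [J J0 Jc Jco] /= IJ; move: J0 Jc Jco; rewrite -IJ.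
by move=> J0 Jc Jco; congr PosetInterval; exact: Prop_irrelevance.
Qed.

Lemma poset_connectedU S S' p : poset_connected S -> poset_connected S' ->
  S p -> S' p -> poset_connected (S `|` S').
Proof.
move=> cS cS' Sp S'p.
have to_p x : (S `|` S') x -> exists s, [/\ path (fun x y => x >=< y)%O x s,
    last x s = p & forall z, z \in s -> (S `|` S') z].
  move=> [Sx|S'x].
    by have [s [? ? sS]] := cS _ _ Sx Sp; exists s; split=> // z /sS; left.
  by have [s [? ? sS]] := cS' _ _ S'x S'p; exists s; split=> // z /sS; right.
have from_p y : (S `|` S') y -> exists s, [/\ path (fun x y => x >=< y)%O p s,
    last p s = y & forall z, z \in s -> (S `|` S') z].
  move=> [Sy|S'y].
    by have [s [? ? sS]] := cS _ _ Sp Sy; exists s; split=> // z /sS; left.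
  by have [s [? ? sS]] := cS' _ _ S'p S'y; exists s; split=> // z /sS; right.
move=> x y /to_p[s [ps ls sS]] /from_p[t [pt lt tS]]; exists (s ++ t).
rewrite cat_path last_cat ls ps pt; split=> // z.
by rewrite mem_cat => /orP[/sS|/tS].
Qed.

Lemma poset_connected2 p q : (p >=< q)%O -> poset_connected [set p; q].
Proof.
move=> pq x y /= xpq ypq; exists [:: y]; split=> //=; last first.
  by move=> z; rewrite inE => /eqP ->.
by rewrite andbT; move: xpq ypq => [->|->] [->|->] //;
  first [exact: comparablexx | rewrite comparable_sym].
Qed.

(** Two points are in the same component when some connected subset joins
    them; unlike with paths, transitivity is then just a union. *)
Definition component Q p : set P :=
  [set q | exists S, [/\ poset_connected S, S `<=` Q, S p & S q]].

Lemma component_sub Q p : component Q p `<=` Q.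
Proof. by move=> q [S [_ SQ _ /SQ]]. Qed.

Lemma component_refl Q p : Q p -> component Q p p.
Proof.
move=> Qp; exists [set p; p]; split; [|by move=> q [] ->|by left|by left].
exact/poset_connected2/comparablexx.
Qed.

Lemma component_comparable Q p q r :
  component Q p q -> Q r -> (q >=< r)%O -> component Q p r.
Proof.
move=> [S [cS SQ Sp Sq]] Qr qr; exists (S `|` [set q; r]); split.
- by apply: (poset_connectedU (p := q)) => //; [exact: poset_connected2|left].
- by move=> z [/SQ//|[->|->//]]; exact: SQ.
- by left.
- by right; right.
Qed.

Lemma component_sym Q p q : component Q p q -> component Q q p.
Proof. by move=> [S [? ? ? ?]]; exists S. Qed.

Lemma component_trans Q p q r :
  component Q p q -> component Q q r -> component Q p r.
Proof.
move=> [S [? SQ ? ?]] [S' [? S'Q ? ?]]; exists (S `|` S').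
split; [exact: (poset_connectedU (p := q))|by move=> z [/SQ|/S'Q]|by left|by right].
Qed.

Lemma component_eq Q p q : component Q p q -> component Q p = component Q q.
Proof.
move=> pq; apply/seteqP; split=> r; apply: component_trans => //.
exact: component_sym.
Qed.

Lemma interval_sub_component Q I p :
  interval_set I `<=` Q -> interval_set I p -> interval_set I `<=` component Q p.
Proof. by move=> IQ Ip q Iq; exists I; split=> //; exact: interval_connected. Qed.

Section ComponentInterval.
Variables (Q : set P) (p : P).
Hypotheses (Q_convex : poset_convex Q) (Qp : Q p).

Lemma component_neq0 : component Q p !=set0.
Proof. by exists p; exact: component_refl. Qed.

Lemma component_convex : poset_convex (component Q p).
Proof.
move=> q r s pq pr qsr; have Qs : Q s.
  exact: Q_convex (component_sub pq) (component_sub pr) qsr.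
by apply: (component_comparable pq) => //; case/andP: qsr => qs _; rewrite /Order.comparable qs.
Qed.

Lemma component_connected : poset_connected (component Q p).
Proof.
move=> q r /component_sym qp pr.
have [S [cS SQ Sq Sr]] := component_trans qp pr.
have [s [? ? sS]] := cS _ _ Sq Sr; exists s; split=> // z /sS Sz.
by apply: (component_trans (component_sym qp)); exists S.
Qed.

Definition component_interval : poset_interval P :=
  PosetInterval component_neq0 component_convex component_connected.

End ComponentInterval.

Definition is_component Q J := forall p, interval_set J p -> interval_set J = component Q p.

Lemma component_interval_is_component Q p (cQ : poset_convex Q) (Qp : Q p) :
  is_component Q (component_interval cQ Qp).
Proof. by move=> q /component_eq. Qed.

Lemma is_component_eq Q J p (cQ : poset_convex Q) (Qp : Q p) :
  is_component Q J -> interval_set J p -> J = component_interval cQ Qp.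
Proof. by move=> cJ Jp; apply: poset_interval_inj; rewrite (cJ _ Jp). Qed.

Lemma is_component_sub Q J : is_component Q J -> interval_set J `<=` Q.
Proof. by move=> cJ p Jp; have := Jp; rewrite (cJ _ Jp) => /component_sub. Qed.

Section Gpd.
Variables (T : finType) (c : T -> int) (Q : T -> set P).
Hypothesis Q_convex : forall A, poset_convex (Q A).

(** Each set [Q A] contributes its weight [c A] to all of its components. *)
Definition component_gpd J : int := \sum_A c A * (`[< is_component (Q A) J >])%:R.

(** An interval [I] included in the convex set [Q A] is below exactly one
    component of it, and below none when it is not included.  In particular
    finitely many components are above [I], even if [Q A] has infinitely many
    of them. *)
Lemma component_gpdP (F : fieldType) (M : pmodule F P) :
  (forall I, (generalized_rank M I)%:Z =
     \sum_A c A * (`[< interval_set I `<=` Q A >])%:R) ->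
  is_gpd M component_gpd.
Proof.
move=> rkE I above; have [p0 Ip0] := interval_neq0 I.
(* The only component of [Q A] through [p0]; the default value [I] is arbitrary. *)
pose J_ A := if pselect (Q A p0) is left Qp then component_interval (@Q_convex A) Qp
             else I.
have J_P A : Q A p0 -> is_component (Q A) (J_ A) /\ interval_set (J_ A) p0.
  move=> Qp; rewrite /J_; case: pselect => // Qp'; split.
    exact: component_interval_is_component.
  exact: component_refl.
have J_uniq A J : is_component (Q A) J -> interval_set I `<=` interval_set J -> J = J_ A.
  move=> cJ IJ; have Qp := is_component_sub cJ (IJ _ Ip0).
  rewrite /J_; case: pselect => // Qp'; apply: is_component_eq => //; exact: IJ.
have dgm_supp J : above J -> (forall A, J <> J_ A) -> component_gpd J = 0.
  move=> IJ JJ; apply: big1 => A _.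
  by case: asboolP => [/J_uniq/(_ IJ)/JJ//|_]; rewrite mulr0.
split.
  apply: (@sub_finite_set _ _ (range J_)); last exact: finite_image.
  move=> J [IJ /= J0]; apply: contrapT => JJ; move/eqP: J0; apply.
  by apply: dgm_supp => // A JA; apply: JJ; exists A.
pose r := undup [seq J_ A | A <- enum T & `[< interval_set I `<=` interval_set (J_ A) >]].
have rP J : (J \in r) <-> exists2 A, interval_set I `<=` interval_set (J_ A) & J = J_ A.
  rewrite mem_undup; split=> [/mapP[A]|[A IA ->]].
    by rewrite mem_filter => /andP[/asboolP IA _] ->; exists A.
  by apply: map_f; rewrite mem_filter mem_enum andbT; exact/asboolP.
rewrite (@fsbigE _ _ _ _ _ r) ?undup_uniq//; first last.
- move=> J IJ Jr; apply: dgm_supp => // A JA; move/negP: Jr; apply.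
  by apply/rP; exists A; rewrite -?JA.
- by move=> J /= /rP[A IA ->].
have -> : \sum_(J <- r | J \in above) component_gpd J = \sum_(J <- r) component_gpd J.
  rewrite big_seq_cond [RHS]big_seq_cond; apply: eq_bigl => J; rewrite andbT.
  by apply: andb_idr => /rP[A IA ->]; rewrite inE.
rewrite rkE /component_gpd exchange_big/=; apply: eq_bigr => A _.
rewrite -big_distrr/=; congr (_ * _).
case: asboolP => [IA|nIA]; last first.
  rewrite big_seq big1// => J /rP[B IB ->]; case: asboolP => // cJ.
  by case: nIA => q /IB; exact: is_component_sub.
have [cA Ap] := J_P A (IA _ Ip0).
have JAr : J_ A \in r.
  by apply/rP; exists A => //; rewrite (cA _ Ap); exact: interval_sub_component.
rewrite (bigD1_seq (J_ A)) ?undup_uniq//= asboolT// big_seq_cond big1 ?addr0//.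
move=> J /andP[/rP[B IB JB] JA]; case: asboolP => // cJ.
by move/eqP: JA => []; apply: J_uniq; rewrite // JB.
Qed.

(** A point comparable to [p0] is in the component of [p0] in [Q A] as soon as
    it is in [Q A].  If such points tell the sets [Q A] apart, the components of
    [p0] are pairwise distinct and no two contributions meet on them, so none
    of the nonzero weights is cancelled. *)
Lemma component_gpd_size (p0 : P) :
  (forall A, Q A p0) ->
  (forall A B, (forall q, (q >=< p0)%O -> Q A q -> Q B q) -> 
               (forall q, (q >=< p0)%O -> Q B q -> Q A q) -> A = B) ->
  forall (R : realType) (x : R), gpd_size_le component_gpd x ->
  #|[set A | c A != 0]%SET|%:R <= x.
Proof.
move=> Qp0 Q_inj R x [n [card_n]]; apply: le_trans; rewrite ler_nat.
pose J_ A := component_interval (@Q_convex A) (Qp0 A).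
have J_at A q : (q >=< p0)%O -> interval_set (J_ A) q <-> Q A q.
  move=> qp; split; first exact: component_sub.
  move=> Qq; apply: (component_comparable (component_refl (Qp0 A))) => //.
  by rewrite comparable_sym.
have J_inj : injective J_.
  move=> A B JAB; apply: Q_inj => q qp /J_at => /(_ qp).
    by rewrite JAB => /J_at; apply.
  by rewrite -JAB => /J_at; apply.
have J_gpd A : component_gpd (J_ A) = c A.
  rewrite /component_gpd (bigD1 A)//= asboolT ?mulr1; last first.
    exact: component_interval_is_component.
  rewrite big1 ?addr0// => B BA; case: asboolP => [cB|_]; last by rewrite mulr0.
  have := is_component_eq (@Q_convex B) (Qp0 B) cB (component_refl (Qp0 A)).
  by move=> /J_inj AB; rewrite AB eqxx in BA.
have supp_fin : finite_set [set J | component_gpd J != 0] by exists n.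
have cardX : #|` fset_set [set J | component_gpd J != 0]| = n.
  exact: card_fset_set.
pose D := [fset J_ A | A in [set A | c A != 0]%SET]%fset.
have -> : #|[set A | c A != 0]%SET| = #|` D| by rewrite card_imfset// cardE.
rewrite -cardX; apply: fsubset_leq_card; apply/fsubsetP => _ /imfsetP[A /= cA ->].
by rewrite in_fset_set // inE /= J_gpd; rewrite inE in cA.
Qed.

End Gpd.
End Components.

(** * Chains and cycles *)

Section Chains.
Variables (F : fieldType) (V : finType).
Local Notation chain := {ffun {set V} -> F^o}.
Implicit Types (c : chain) (s t : {set V}) (K : complex V).

Lemma simplex_chainE s t : simplex_chain F s t = (t == s)%:R.
Proof. by rewrite ffunE. Qed.

Lemma chain_sumE c : c = \sum_s (c s : F) *: simplex_chain F s.
Proof.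
apply/ffunP => t; rewrite sum_ffunE (bigD1 t)//= big1 ?addr0.
  by rewrite !ffunE eqxx [RHS]mulr1.
by move=> s /negPf st; rewrite !ffunE eq_sym st [LHS]mulr0.
Qed.

Lemma mem_chains n K c : reflect (forall s, c s != 0 -> s \in simplices K /\ #|s| = n.+1)
  (c \in chains F n K).
Proof.
apply: (iffP idP) => [|cK].
  rewrite /chains; set r := [seq _ | _ <- _ & _]; pose X := in_tuple r.
  rewrite -[r]/(tval X) => /coord_span -> s; apply: contraNP => /not_andP sK.
  rewrite sum_ffunE big1// => i _; rewrite ffunE.
  have : X`_i \in X by exact: mem_nth.
  move=> /mapP[t]; rewrite mem_filter mem_enum => /andP[/eqP nt tK] ->.
  rewrite simplex_chainE; case: eqP => [st|_]; last by rewrite [LHS]mulr0.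
  by exfalso; case: sK; rewrite st.
rewrite (chain_sumE c); apply: memv_suml => s _.
have [->|/cK[sK sn]] := eqVneq (c s) 0; first by rewrite scale0r mem0v.
apply/memvZ/memv_span/mapP; exists s => //.
by rewrite mem_filter sn eqxx mem_enum.
Qed.

Lemma boundaryE c : boundary F V c = \sum_s (c s : F) *: simplex_boundary F s.
Proof. by rewrite lfunE. Qed.

Lemma boundary_simplex s : boundary F V (simplex_chain F s) = simplex_boundary F s.
Proof.
rewrite boundaryE (bigD1 s)//= big1 ?addr0 ?simplex_chainE ?eqxx ?scale1r//.
by move=> t /negPf ts; rewrite simplex_chainE ts scale0r.
Qed.

Lemma boundary_at c t : boundary F V c t = \sum_s c s * simplex_boundary F s t.
Proof. by rewrite boundaryE sum_ffunE; apply: eq_bigr => s _; rewrite ffunE. Qed.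

(** The sign between the edge from [x] to [y] and the same edge oriented by the
    order on the vertices. *)
Definition orientation (x y : V) : F := (-1) ^+ (enum_rank y < enum_rank x)%N.

Lemma orientation_sq x y : orientation x y * orientation x y = 1.
Proof. by rewrite -expr2 sqrr_sign. Qed.

Lemma orientation_neq0 x y : orientation x y != 0.
Proof. by rewrite signr_eq0. Qed.

Lemma set2D1 (x y : V) : x != y -> ([set x; y] :\ x = [set y])%SET.
Proof.
move=> xy; apply/setP => z; rewrite !inE; have [->|//] := eqVneq z x.
by rewrite (negPf xy).
Qed.

Lemma vertex_position2 (x y : V) : x != y ->
  vertex_position [set x; y] x = (enum_rank y < enum_rank x)%N.
Proof.
move=> xy; rewrite /vertex_position; case: ltnP => yx.
  rewrite (_ : [set _ in _ | _]%SET = [set y]%SET) ?cards1//.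
  apply/setP => z; rewrite !inE; have [->|zx] := eqVneq z x.
    by rewrite ltnn (negPf xy).
  by have [->|] := eqVneq z y.
rewrite (_ : [set _ in _ | _]%SET = finset.set0) ?cards0//.
apply/setP => z; rewrite !inE; have [->|zx] := eqVneq z x; first by rewrite ltnn.
by have [->|//] := eqVneq z y; rewrite ltnNge yx.
Qed.

Lemma simplex_boundary2 (x y : V) : x != y ->
  simplex_boundary F [set x; y]%SET =
  orientation x y *: (simplex_chain F [set y]%SET - simplex_chain F [set x]%SET).
Proof.
move=> xy; have yx : y != x by rewrite eq_sym.
have set1_neq0 (z : V) : [set z]%SET != finset.set0 by rewrite -cards_eq0 cards1.
rewrite /simplex_boundary big_mkcondr/= big_setU1 ?inE//= big_set1.
rewrite set2D1// [X in (X :\ y)%SET]finset.setUC set2D1// !set1_neq0.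
rewrite vertex_position2// [X in vertex_position X]finset.setUC vertex_position2//.
rewrite /orientation scalerBr; congr (_ + _); rewrite -scaleNr; congr (_ *: _).
have : (enum_rank x != enum_rank y :> nat).
  by apply: contra_neq xy => /val_inj/enum_rank_inj.
by case: ltngtP => //= _ _; rewrite ?expr0 ?expr1 ?opprK.
Qed.

Definition oriented_edge (x y : V) : chain :=
  orientation x y *: simplex_chain F [set x; y]%SET.

Lemma boundary_oriented_edge (x y : V) : x != y ->
  boundary F V (oriented_edge x y) =
  simplex_chain F [set y]%SET - simplex_chain F [set x]%SET.
Proof.
move=> xy; rewrite /oriented_edge linearZ/= boundary_simplex simplex_boundary2//.
by rewrite scalerA orientation_sq scale1r.
Qed.

(** The boundary has at the vertex [y] the coefficient of [s] up to sign.  All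
    later computations of cycle spaces of graphs use only this fact. *)
Lemma cycle_isolated_edge K c (y : V) s : c \in cycles F 1 K ->
  #|s| = 2 -> y \in s -> (forall t, c t != 0 -> y \in t -> t = s) -> c s = 0.
Proof.
move=> /memv_capP[/mem_chains cK]; rewrite memv_ker => /eqP dc s2 ys only.
have [x xy sE] : exists2 x, y != x & s = [set y; x]%SET.
  have /cards1P[x sy] : #|(s :\ y)%SET| == 1%N.
    by move/eqP: s2; rewrite (cardsD1 y) ys.
  have : x \in (s :\ y)%SET by rewrite sy inE.
  by rewrite !inE => /andP[xy _]; exists x; rewrite 1?eq_sym// -sy finset.setD1K.
have := congr1 (fun c : chain => c [set y]%SET) dc.
rewrite boundary_at (bigD1 s)//= big1 ?addr0; last first.
  move=> t ts; have [->|ct] := eqVneq (c t) 0; first by rewrite mul0r.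
  have /cards2P[u [v [uv tE]]] : #|t| == 2 by apply/eqP; case: (cK t ct).
  have yt : y \notin t by apply: contra ts => yt; rewrite (only t ct yt).
  move: yt; rewrite tE !inE negb_or => /andP[yu yv].
  rewrite simplex_boundary2// !ffunE !(inj_eq (@set1_inj _)).
  by rewrite (negPf yu) (negPf yv) subrr [X in _ * X]mulr0 mulr0.
rewrite sE simplex_boundary2// !ffunE.
rewrite (inj_eq (@set1_inj _)) (negPf xy) eqxx sub0r => /eqP.
by rewrite mulf_eq0 => /orP[/eqP//|]; 
  rewrite [X in X == _]mulrN1 oppr_eq0 (negPf (orientation_neq0 _ _)).
Qed.

End Chains.

(** * Homology of graphs and of full simplices *)

Section Homology.
Variables (F : fieldType) (V : finType).
Local Notation chain := {ffun {set V} -> F^o}.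
Implicit Types (c : chain) (s t : {set V}) (K L : complex V).

Lemma homology_eq0 n K : (cycles F n K <= boundaries F n K)%VS ->
  forall x : homology F n K, x = 0.
Proof.
move=> ZB x; rewrite -[x]quotv_reprK -[RHS](linear0 (quotv_pi _)).
apply/eqP; rewrite quotv_pi_eq subr0 -memv_preim lfunE /=.
exact: (subvP ZB) (subvsP _).
Qed.

(** The cycle picked by the representative of a class.  It depends on the class
    linearly when [K] has no simplex of dimension [n + 1]: then [0] is the only
    boundary and a class contains just one cycle. *)
Definition homology_cycle n K (x : homology F n K) : chain := vsval (quotv_repr x).

Section TopDimension.
Variables (n : nat) (K : complex V).
Hypothesis K_dim : forall s, s \in simplices K -> #|s| <> n.+2.

Lemma boundaries_top : boundaries F n K = 0%VS.
Proof.
apply/eqP; rewrite -subv0; apply/subvP => _ /memv_imgP[c /mem_chains cK ->].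
suff -> : c = 0 by rewrite linear0 mem0v.
by apply/ffunP => s; rewrite ffunE; apply/eqP; apply: contraT => /cK[/K_dim].
Qed.

Lemma homology_cycle_pi (z : subvs_of (cycles F n K)) :
  homology_cycle (quotv_pi _ z : homology F n K) = vsval z.
Proof.
have B0 c : c \in boundaries F n K -> c = 0.
  by rewrite boundaries_top memv0 => /eqP.
have := quotv_reprK (quotv_pi _ z : homology F n K) => /eqP.
rewrite quotv_pi_eq -memv_preim lfunE /= => /B0/eqP.
by rewrite subr_eq0 => /eqP.
Qed.

Lemma homology_cycle_linear : linear (@homology_cycle n K).
Proof.
move=> a x y; rewrite -[x]quotv_reprK -[y]quotv_reprK -quotv_piP.
by rewrite !homology_cycle_pi linearP.
Qed.

Lemma homology_cycle_inj x : @homology_cycle n K x = 0 -> x = 0.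
Proof.
move=> x0; rewrite -[x]quotv_reprK -[RHS](linear0 (quotv_pi _)).
by congr quotv_pi; apply: val_inj; rewrite linear0.
Qed.

Lemma mem_homology_cycle c :
  (exists x, @homology_cycle n K x = c) <-> c \in cycles F n K.
Proof.
split=> [[x <-]|cK]; first exact: subvsP.
by exists (quotv_pi _ (vsproj (cycles F n K) c)); rewrite homology_cycle_pi vsprojK.
Qed.

End TopDimension.

Lemma homology_cycle_map n K L (x : homology F n K) : K \subset L ->
  (forall s, s \in simplices L -> #|s| <> n.+2) ->
  homology_cycle (homology_map F n K L x) = homology_cycle x.
Proof.
move=> KL L_dim; rewrite -[x]quotv_reprK homology_mapE// !homology_cycle_pi//.
  rewrite vsprojK//; exact: (subvP (cyclesS F n KL)) (subvsP _).
by move=> s /(fintype.subsetP KL)/L_dim.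
Qed.

End Homology.

Section Cone.
Variables (F : fieldType) (V : finType) (B : {set V}) (a : V).
Local Notation chain := {ffun {set V} -> F^o}.
Hypotheses (aB : a \in B)
  (a_min : forall b, b \in B -> (enum_rank a <= enum_rank b)%N).

(* As [a] comes first in the order on [B], it takes position [0] in a simplex,
   and the cone carries no sign. *)
Let cone_simplex (s : {set V}) : chain :=
  if a \in s then 0 else simplex_chain F (a |: s)%SET.

Let cone (c : chain) : chain := \sum_s (c s : F) *: cone_simplex s.

Let cone_linear : linear cone.
Proof.
move=> k x y; rewrite /cone scaler_sumr -big_split /=.
by apply: eq_bigr => s _; rewrite !ffunE scalerDl scalerA.
Qed.

HB.instance Definition _ := GRing.isLinear.Build F chain chain _ cone cone_linear.

Let cone_simplexE s : cone (simplex_chain F s) = cone_simplex s.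
Proof.
rewrite /cone (bigD1 s)//= big1 ?addr0 ?simplex_chainE ?eqxx ?scale1r//.
by move=> t /negPf ts; rewrite simplex_chainE ts scale0r.
Qed.

(* On vertices the identity fails, the complex being unaugmented. *)
Let cone_homotopy (s : {set V}) : s \subset B -> (1 < #|s|)%N ->
  boundary F V (cone_simplex s) + cone (simplex_boundary F s) = simplex_chain F s.
Proof.
move=> /fintype.subsetP sB s_gt1.
have sD1 v : v \in s -> (s :\ v)%SET != finset.set0.
  by move=> vs; rewrite -cards_eq0; move: s_gt1; rewrite (cardsD1 v) vs; case: #|_|.
have pos_a (t : {set V}) : t \subset B -> vertex_position t a = 0%N.
  move=> /fintype.subsetP tB; apply/eqP; rewrite cards_eq0; apply/eqP/setP => v.
  rewrite !inE; apply/negP => /andP[/tB/a_min]; by rewrite leqNgt => /negP.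
rewrite [cone _]linear_sum /cone_simplex; case: ifPn => [as_|a_s].
  rewrite linear0 add0r (bigD1 a) ?as_ ?sD1//= big1 ?addr0.
    rewrite linearZ_LR/= cone_simplexE /cone_simplex !inE eqxx/=.
    by rewrite finset.setD1K// pos_a ?expr0 ?scale1r//; exact/fintype.subsetP.
  move=> v /andP[/andP[vs _] va]; rewrite linearZ_LR/= cone_simplexE /cone_simplex.
  by rewrite !inE eq_sym va as_ scaler0.
rewrite boundary_simplex /simplex_boundary big_mkcondr/= big_setU1//=.
have asK : ((a |: s) :\ a = s)%SET by rewrite finset.setU1K.
rewrite asK pos_a ?expr0 ?scale1r; last first.
  by apply/fintype.subsetP => v; rewrite !inE => /orP[/eqP->|/sB].
rewrite -cards_eq0 -lt0n (ltnW s_gt1) -addrA -[RHS]addr0; congr (_ + _).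
rewrite [X in _ + X]big_mkcondr/= -big_split/= big1// => v vs.
have va : v != a by apply: contraNneq a_s => <-.
have -> : ((a |: s) :\ v = a |: (s :\ v))%SET.
  by apply/setP => w; rewrite !inE; have [->|//] := eqVneq w a; rewrite eq_sym va.
rewrite sD1// ifT; last by rewrite -cards_eq0 cardsU1 !inE (negPf a_s) andbF.
rewrite linearZ_LR/= cone_simplexE /cone_simplex !inE (negPf a_s) andbF.
have -> : vertex_position (a |: s) v = (vertex_position s v).+1.
  rewrite /vertex_position (cardsD1 a) !inE eqxx/=.
  have -> : (enum_rank a < enum_rank v)%N.
    rewrite ltn_neqAle a_min ?sB// andbT; apply: contraNneq va.
    by move=> /val_inj/enum_rank_inj ->.
  rewrite add1n; congr (#|pred_of_set _|.+1); apply/setP => w; rewrite !inE.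
  have [->|//] := eqVneq w a; by rewrite (negPf a_s).
by rewrite exprS mulN1r scaleNr addNr.
Qed.

(** A cycle is the boundary of its cone with apex [a]. *)
Lemma full_simplex_acyclic (K : complex V) :
  (forall s : {set V}, (s \in simplices K) = (s != finset.set0) && (s \subset B)) ->
  (cycles F 1 K <= boundaries F 1 K)%VS.
Proof.
move=> KE; apply/subvP => c /memv_capP[/mem_chains cK].
rewrite memv_ker => /eqP dc; apply/memv_imgP; exists (cone c).
  apply/mem_chains => s.
  rewrite /cone sum_ffunE => ns; have [t] : exists t, c t * cone_simplex t s != 0.
    apply/existsP; apply: contraNT ns; rewrite negb_exists => /forallP t0.
    rewrite big1// => t _; rewrite ffunE; apply/eqP.
    by have := t0 t; rewrite negbK.
  rewrite mulf_eq0 negb_or => /andP[/cK[]]; rewrite KE => /andP[_ tB] t2.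
  rewrite /cone_simplex; case: ifPn => [|a_t]; first by rewrite ffunE eqxx.
  rewrite simplex_chainE; have [-> _|] := eqVneq s (a |: t)%SET; last by rewrite eqxx.
  rewrite KE cardsU1 a_t t2; split=> //; apply/andP; split.
    by rewrite -cards_eq0 cardsU1 a_t.
  by rewrite finset.subUset finset.sub1set aB.
have cE : c = boundary F V (cone c) + cone (boundary F V c).
  have -> : boundary F V (cone c) = \sum_s (c s : F) *: boundary F V (cone_simplex s).
    by rewrite linear_sum; apply: eq_bigr => s _; rewrite linearZ.
  have -> : cone (boundary F V c) = \sum_s (c s : F) *: cone (simplex_boundary F s).
    by rewrite boundaryE linear_sum; apply: eq_bigr => s _; rewrite linearZ.
  rewrite [LHS](chain_sumE c) -big_split/=; apply: eq_bigr => s _; rewrite -scalerDr.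
  have [->|/cK[sK s2]] := eqVneq (c s) 0; first by rewrite !scale0r.
  rewrite cone_homotopy// ?s2//; by move: sK; rewrite KE => /andP[].
by rewrite {1}cE dc linear0 addr0.
Qed.

End Cone.

(** * Theta graphs *)

Section Theta.
Variables (F : fieldType) (V : finType) (n : nat).
Variables (mid : 'I_n -> V) (pole : bool -> V).
Hypotheses (mid_inj : injective mid) (pole_inj : injective pole)
  (mid_pole : forall i b, mid i != pole b).
Local Notation chain := {ffun {set V} -> F^o}.

Definition strand_edge (i : 'I_n) (b : bool) : {set V} := [set mid i; pole b]%SET.

Lemma card_strand_edge i b : #|strand_edge i b| = 2.
Proof. by rewrite cards2 mid_pole. Qed.

Lemma mid_strand_edge i j b : (mid i \in strand_edge j b) = (i == j).
Proof. by rewrite !inE (negPf (mid_pole i b)) orbF (inj_eq mid_inj). Qed.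

Lemma pole_strand_edge a i b : (pole a \in strand_edge i b) = (a == b).
Proof. by rewrite !inE eq_sym (negPf (mid_pole i a)) (inj_eq pole_inj). Qed.

Lemma strand_edge_eq i a j b : (strand_edge i a == strand_edge j b) = (i == j) && (a == b).
Proof.
apply/eqP/andP => [e|[/eqP-> /eqP->]//]; split.
  by rewrite -(mid_strand_edge i j b) -e mid_strand_edge.
by rewrite -(pole_strand_edge a j b) -e pole_strand_edge.
Qed.

(** A strand is the path from one pole to the other through a middle vertex. *)
Definition full_strands (G : {set {set V}}) : {set 'I_n} :=
  [set i | (strand_edge i false \in G) && (strand_edge i true \in G)]%SET.

Variable G : complex V.
(* All edges are on strands, except for pendant ones: some vertex [y] of theirs
   is on no other edge. *)
Hypothesis G_edges : forall s, s \in simplices G -> #|s| = 2 ->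
  (exists i b, s = strand_edge i b) \/
  (exists2 y, y \in s & forall t, t \in simplices G -> #|t| = 2 -> y \in t -> t = s).
Local Notation S := (full_strands G).
Implicit Types (c : chain).

(** A cycle avoids the pendant edges, then, at each middle vertex, also the
    strands of which only one edge is in [G]. *)
Lemma cycle_strand_edge c t : c \in cycles F 1 G -> c t != 0 ->
  exists i b, i \in S /\ t = strand_edge i b.
Proof.
move=> cZ; have cG t' : c t' != 0 -> t' \in simplices G /\ #|t'| = 2.
  by have /memv_capP[/mem_chains + _] := cZ; apply.
have on_strand t' : c t' != 0 -> exists i b, t' = strand_edge i b.
  move=> ct; have [tG t2] := cG _ ct; have [//|[y yt only]] := G_edges tG t2.
  case/eqP: ct; apply: (cycle_isolated_edge cZ t2 yt) => t'' /cG[? ?].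
  exact: only.
move=> ct; have [i [b tE]] := on_strand _ ct; exists i, b; split=> //.
have other : strand_edge i (~~ b) \in simplices G.
  have [c0|/cG[]//] := eqVneq (c (strand_edge i (~~ b))) 0.
  case/eqP: ct; apply: (cycle_isolated_edge cZ (y := mid i)).
  - by rewrite tE card_strand_edge.
  - by rewrite tE mid_strand_edge.
  move=> t' ct'; have [j [b' t'E]] := on_strand _ ct'.
  rewrite t'E mid_strand_edge => /eqP ij; subst j; rewrite tE.
  have [->//|bb'] := eqVneq b' b; move: ct'; rewrite t'E.
  have -> : b' = ~~ b by case: b b' bb' {tE t'E c0} => [] [].
  by rewrite c0 eqxx.
have := proj1 (cG _ ct); rewrite tE inE.
by case: (b) other => /= -> ->.
Qed.

(** The flows of a cycle through all complete strands but one determine it: at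
    the pole [false] they determine the last flow, and at the middle vertices
    the second half of each strand. *)
Lemma theta_rigid (s0 : 'I_n) c : c \in cycles F 1 G ->
  (forall i, i \in S -> i != s0 -> c (strand_edge i false) = 0) -> c = 0.
Proof.
move=> cZ c0; have c_false i : c (strand_edge i false) = 0.
  have [iS|iS] := boolP (i \in S); last first.
    apply/eqP; apply: contraR iS => /(cycle_strand_edge cZ)[j [b [jS /eqP]]].
    by rewrite strand_edge_eq => /andP[/eqP->].
  have [->|is0] := eqVneq i s0; last exact: c0.
  apply: (cycle_isolated_edge cZ (y := pole false)); first exact: card_strand_edge.
    by rewrite pole_strand_edge.
  move=> t ct; have [j [b [jS tE]]] := cycle_strand_edge cZ ct.
  rewrite tE pole_strand_edge => /eqP bE; rewrite -bE in tE *; congr strand_edge.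
  by apply/eqP; apply: contraNT ct => js0; rewrite tE c0.
apply/ffunP => t; rewrite ffunE; apply/eqP; apply: contraT => ct.
have [i [b [iS tE]]] := cycle_strand_edge cZ ct.
case: b tE => tE; last by rewrite tE c_false eqxx in ct.
case/eqP: ct; apply: (cycle_isolated_edge cZ (y := mid i)).
- by rewrite tE card_strand_edge.
- by rewrite tE mid_strand_edge.
move=> t' ct'; have [j [b' [_ t'E]]] := cycle_strand_edge cZ ct'.
rewrite tE t'E mid_strand_edge => /eqP <-; congr strand_edge.
by case: b' t'E => // t'E; rewrite t'E c_false eqxx in ct'.
Qed.

Let strand i : chain :=
  oriented_edge F (pole false) (mid i) + oriented_edge F (mid i) (pole true).

Let boundary_strand i : boundary F V (strand i) =
  simplex_chain F [set pole true]%SET - simplex_chain F [set pole false]%SET.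
Proof.
rewrite linearD /= !boundary_oriented_edge// 1?eq_sym//.
by rewrite addrC addrA subrK.
Qed.

Let strand_false i j : strand i (strand_edge j false) =
  orientation F (pole false) (mid i) * (i == j)%:R.
Proof.
rewrite !ffunE.
rewrite [X in _ == X]finset.setUC -/(strand_edge i false) -/(strand_edge i true).
by rewrite !strand_edge_eq andbF andbT [X in _ + X]mulr0 addr0 eq_sym.
Qed.

Let mem_strand_diff i j : i \in S -> j \in S -> strand i - strand j \in cycles F 1 G.
Proof.
move=> iS jS; have strand_chain k : k \in S -> strand k \in chains F 1 G.
  have edge_chain b : strand_edge k b \in simplices G ->
      simplex_chain F (strand_edge k b) \in chains F 1 G.
    move=> kG; apply/mem_chains => s; rewrite simplex_chainE.
    have [-> _|] := eqVneq s (strand_edge k b); last by rewrite eqxx.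
    by rewrite card_strand_edge.
  rewrite inE => /andP[k0 k1]; apply: memvD; apply: memvZ.
    by rewrite finset.setUC; exact: edge_chain.
  exact: edge_chain.
apply/memv_capP; split; first by apply: memvB; exact: strand_chain.
by rewrite memv_ker linearB /= !boundary_strand subrr.
Qed.

(** The differences between the strand of a fixed [s0] and the other complete
    strands form a basis: the edges at the pole [false] separate them, and by
    [theta_rigid] they span. *)
Lemma theta_cycle_basis : exists u : 'I_(#|S|.-1) -> chain,
  [/\ forall i, u i \in cycles F 1 G,
      forall k : 'I_(#|S|.-1) -> F, \sum_i k i *: u i = 0 -> forall i, k i = 0
    & forall c, c \in cycles F 1 G ->
        exists k : 'I_(#|S|.-1) -> F, c = \sum_i k i *: u i].
Proof.
have [S0|/set0Pn[s0 s0S]] := eqVneq S finset.set0.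
  rewrite S0 cards0; exists (fun=> 0); split=> [i|k _ []//|c cZ].
    exact: mem0v.
  exists (fun=> 0); rewrite big_ord0; apply/ffunP => t; rewrite ffunE.
  apply/eqP; apply: contraT => /(cycle_strand_edge cZ)[i [b []]].
  by rewrite S0 inE.
have cardS : #|S|.-1 = #|(S :\ s0)%SET| by rewrite [in LHS](cardsD1 s0) s0S.
rewrite cardS; pose s (j : 'I_(#|(S :\ s0)%SET|)) : 'I_n := enum_val j.
have sP j : s j != s0 /\ s j \in S by have := enum_valP j; rewrite !inE => /andP[].
pose u j := strand (s j) - strand s0.
have uZ j : u j \in cycles F 1 G by apply: mem_strand_diff => //; case: (sP j).
have sumu k j : (\sum_i k i *: u i) (strand_edge (s j) false) =
    k j * orientation F (pole false) (mid (s j)).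
  rewrite sum_ffunE (bigD1 j)//= big1 ?addr0.
    rewrite ffunE [in LHS]ffunE [X in _ *: (_ + X)]ffunE !strand_false eqxx.
    have [/negPf sj _] := sP j.
    by rewrite [s0 == _]eq_sym sj mulr0 subr0 mulr1.
  move=> i ij; rewrite ffunE [in LHS]ffunE [X in _ *: (_ + X)]ffunE !strand_false.
  have [/negPf sj _] := sP j; rewrite [s0 == _]eq_sym sj.
  by rewrite (inj_eq enum_val_inj) (negPf ij) !mulr0 subr0 scaler0.
exists u; split=> // [k k0 j|c cZ].
  have := sumu k j; rewrite k0 ffunE => /esym/eqP.
  by rewrite mulf_eq0 (negPf (orientation_neq0 _ _ _)) orbF => /eqP.
pose k j := c (strand_edge (s j) false) * orientation F (pole false) (mid (s j)).
exists k; apply/eqP; rewrite -subr_eq0; apply/eqP; apply: (theta_rigid (s0 := s0)).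
  by apply: memvB => //; apply: memv_suml => j _; apply: memvZ.
move=> i iS is0; have iS' : i \in (S :\ s0)%SET by rewrite in_setD1 is0.
have -> : i = s (enum_rank_in iS' i) by rewrite /s enum_rankK_in.
rewrite ffunE [X in _ + X]ffunE sumu /k -mulrA orientation_sq mulr1.
by rewrite subrr.
Qed.

End Theta.

Section ThetaRank.
Variables (F : fieldType) (V : finType) (n : nat).
Variables (mid : 'I_n -> V) (pole : bool -> V).
Hypotheses (mid_inj : injective mid) (pole_inj : injective pole)
  (mid_pole : forall i b, mid i != pole b).
Variables (d : Order.disp_t) (P : porderType d) (K : filtration P V).
Variable I : poset_interval P.
Hypothesis K_dim : forall p, interval_set I p ->
  forall s, s \in simplices (K p) -> #|s| <> 3.
Hypothesis K_edges : forall p, interval_set I p ->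
  forall s, s \in simplices (K p) -> #|s| = 2 ->
  (exists i b, s = strand_edge mid pole i b) \/
  (exists2 y, y \in s &
     forall t, t \in simplices (K p) -> #|t| = 2 -> y \in t -> t = s).

(* The intersection of all complexes over [I]. *)
Let G_simplices : {set {set V}} :=
  [set s | `[< forall p, interval_set I p -> s \in simplices (K p) >]]%SET.

Let G_complex : is_complex G_simplices.
Proof.
split=> [|s t].
  rewrite inE; apply/asboolP => G0; have [p Ip] := interval_neq0 I.
  by have := G0 p Ip; case: (K p) => /= ? [/negP].
rewrite !inE => /asboolP sG ts t0; apply/asboolP => p Ip.
by have [_] := complexP (K p); apply; [exact: sG|exact: ts|].
Qed.

Let G := Complex G_complex.

(** All the maps of the module are inclusions of cycle spaces, so a section over
    [I] is a cycle common to all its complexes, and it survives in the colimit. *)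
Lemma theta_generalized_rank :
  generalized_rank (homology_module F 1 K) I = #|full_strands mid pole G_simplices|.-1.
Proof.
have G_edges s : s \in simplices G -> #|s| = 2 ->
    (exists i b, s = strand_edge mid pole i b) \/
    (exists2 y, y \in s & forall t, t \in simplices G -> #|t| = 2 -> y \in t -> t = s).
  rewrite inE => /asboolP sG s2; have [p Ip] := interval_neq0 I.
  have [|[y ys only]] := K_edges Ip (sG p Ip) s2; first by left.
  by right; exists y => // t; rewrite inE => /asboolP tG; apply: only; exact: tG.
have [u [uZ u_free u_span]] := theta_cycle_basis F mid_inj pole_inj mid_pole G_edges.
have mem_G c : c \in cycles F 1 G <-> forall p, interval_set I p -> c \in cycles F 1 (K p).
  split=> [/memv_capP[/mem_chains cG dc] p Ip|cK].
    apply/memv_capP; split=> //; apply/mem_chains => s cs.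
    by have [+ ->] := cG s cs; rewrite inE => /asboolP sG; split=> //; exact: sG.
  have [p0 Ip0] := interval_neq0 I.
  have /memv_capP[/mem_chains c2 dc] := cK _ Ip0.
  apply/memv_capP; split=> //; apply/mem_chains => s cs.
  have [_ ->] := c2 s cs; split=> //; rewrite inE; apply/asboolP => p Ip.
  by have /memv_capP[/mem_chains/(_ s cs)[]] := cK p Ip.
apply: (@generalized_rank_inclusions F d P (homology_module F 1 K) I _
  (fun p => @homology_cycle F V 1 (K p)) _ _ _ _ u) => //.
- by move=> p Ip; apply: homology_cycle_linear; exact: K_dim.
- by move=> p Ip v; exact: homology_cycle_inj.
- move=> p q pq v Ip Iq; apply: homology_cycle_map; first exact: filt_mono.
  exact: K_dim.
- move=> i p Ip; apply/mem_homology_cycle; first exact: K_dim.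
  by move: p Ip; apply/mem_G.
- move=> c cI; apply: u_span; apply/mem_G => p Ip.
  by apply/mem_homology_cycle; [exact: K_dim|exact: cI].
Qed.

End ThetaRank.

(** * Alternating sums over subsets *)

(** Toggling an element [x] of [S] pairs the subsets with opposite signs. *)
Lemma sum_subsets_sign (T : finType) (S : {set T}) : S != finset.set0 ->
  \sum_(A : {set T} | A \subset S) (-1) ^+ #|A| = 0 :> int.
Proof.
move=> /finset.set0Pn[x xS].
rewrite (bigID (fun A : {set T} => x \in A)) /=.
rewrite (reindex_onto (fun A => (x |: A)%SET) (fun A => (A :\ x)%SET)) /=; last first.
  by move=> A /andP[_ xA]; rewrite finset.setD1K.
rewrite -[X in _ + X]opprK -sumrN; apply/eqP; rewrite subr_eq0; apply/eqP.
apply: eq_big => [A|A /andP[_ /eqP xA]].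
  rewrite finset.subUset finset.sub1set xS !inE eqxx /= andbT; congr (_ && _).
  apply/eqP/idP => [<-|xA]; first by rewrite !inE eqxx.
  by rewrite finset.setU1K.
have : x \notin A by rewrite -xA !inE eqxx.
by move=> xA'; rewrite cardsU1 xA' exprS mulN1r.
Qed.

(** The empty set and the singletons contribute [1 - |S|] to the sum over all
    subsets, which vanishes unless [S] is empty.  This is the Moebius inversion
    of the dimension of the cycle space of a theta graph. *)
Lemma sum_large_subsets_sign (T : finType) (S : {set T}) :
  \sum_(A : {set T} | (1 < #|A|)%N && (A \subset S)) (-1) ^+ #|A| = (#|S|.-1)%:Z.
Proof.
have := @sum_subsets_sign T S.
rewrite (bigID (fun A : {set T} => (1 < #|A|)%N)) /=.
under eq_bigl do rewrite andbC.
set big := \sum_(i | _) _.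
have -> : \sum_(A : {set T} | (A \subset S) && ~~ (1 < #|A|)%N) (-1) ^+ #|A| =
    1 - (#|S|)%:Z.
  rewrite (bigD1 finset.set0) ?finset.sub0set ?cards0//= expr0; congr (_ + _).
  transitivity (\sum_(A in [set [set x] | x in S]%SET) (-1 : int)).
    apply: eq_big => [A|A /andP[/andP[_ +] A0]]; last first.
      rewrite -leqNgt => A1; have -> : #|A| = 1%N; last by rewrite expr1.
      by apply/eqP; rewrite eqn_leq A1 lt0n cards_eq0.
    rewrite -leqNgt; apply/idP/imsetP => [/andP[/andP[AS A1] A0]|[x xS ->]].
      have /cards1P[x Ax] : #|A| == 1%N by rewrite eqn_leq A1 lt0n cards_eq0.
      by exists x => //; rewrite -finset.sub1set -Ax.
    by rewrite finset.sub1set xS cards1 -cards_eq0 cards1.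
  rewrite sumr_const card_imset; last exact: set1_inj.
  by rewrite mulNrn natz.
have [S0 _|S0 /(_ isT)/eqP] := eqVneq S finset.set0.
  rewrite /big S0 cards0 big1// => A /andP[+ A0]; move: A0.
  by rewrite finset.subset0 => /eqP ->; rewrite cards0.
have := S0; rewrite -cards_eq0; case: #|S| => // k _.
by rewrite intS opprD addNKr subr_eq0 => /eqP.
Qed.

Lemma card_large_subsets (T : finType) :
  (2 ^ #|T| - #|T|.+1 <= #|[set A : {set T} | (1 < #|A|)%N]|)%N.
Proof.
set L := [set A : {set T} | _]%SET.
have -> : (2 ^ #|T| = #|{: {set T}}|)%N by rewrite -[RHS]cardsT -powersetT card_powerset cardsT.
rewrite -(cardsC L) leq_subLR addnC leq_add2r -card_option -cardsT.
pose h (z : option T) : {set T} := if z is Some x then [set x]%SET else finset.set0.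
apply: leq_trans (leq_imset_card h _); apply: subset_leq_card.
apply/fintype.subsetP => A; rewrite !inE -leqNgt leq_eqVlt ltnS leqn0 cards_eq0.
move=> /orP[/cards1P[x ->]|/eqP->]; apply/imsetP; first by exists (Some x).
by exists None.
Qed.

(** * A weighted theta graph *)

(** The vertices are hubs [(h, None)] and leaves [(h, Some k)]; the hubs are the
    [n] middle vertices [inl i] and the two poles [inr b].  Every hub has [n]
    leaves, through which its degree is prescribed. *)
Definition theta_vertex (n : nat) : finType := (('I_n + bool) * option 'I_n)%type.

(** The stage, between [0] and [n], at which an edge appears; [n.+1] stands for
    the pairs that are joined only when the complex becomes a full simplex.  The
    [k]-th leaf of the [i]-th middle vertex appears at stage [k], except that
    the [i]-th one is delayed by one stage.  So at stage [j] the middle vertices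
    have the same degree, except the [j]-th one, which has one less and catches
    up at the next stage. *)
Definition edge_level n (x y : theta_vertex n) : nat :=
  match x, y with
  | (inl _, None), (inr _, None) | (inr _, None), (inl _, None) => 0
  | (h, None), (h', Some k) | (h', Some k), (h, None) =>
    if h == h' then (if h is inl i then k + (k == i) else 0)%N else n.+1
  | _, _ => n.+1
  end.

(** A proper [2]-coloring of the graph: it rules out triangles. *)
Definition side n (x : theta_vertex n) : bool :=
  match x with
  | (inl _, None) | (inr _, Some _) => false
  | (inr _, None) | (inl _, Some _) => true
  end.

Section ThetaVertices.
Variable n : nat.
Implicit Types (x y : theta_vertex n).

Lemma edge_levelC x y : edge_level x y = edge_level y x.
Proof. by case: x y => [[i|b] [k|]] [[j|b'] [k'|]]. Qed.

Lemma edge_level_max x y : (edge_level x y <= n.+1)%N.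
Proof.
have aux (k i : 'I_n) : (k + (k == i) <= n.+1)%N.
  by rewrite -[n.+1]addn1 leq_add ?leq_b1// ltnW.
case: x y => [[i|b] [k|]] [[j|b'] [k'|]] //=; case: eqP => //.
Qed.

Lemma edge_level_side x y : (edge_level x y <= n)%N -> side x != side y.
Proof.
by case: x y => [[i|b] [k|]] [[j|b'] [k'|]] //=; rewrite ?ltnn//; case: eqP => // _; rewrite ltnn.
Qed.

Lemma edge_level_leaf h k y : (edge_level (h, Some k) y <= n)%N -> y = (h, None).
Proof.
by case: h y => [i|b] [[j|b'] [k'|]] //=; rewrite ?ltnn//; case: eqP => [->|] //; rewrite ltnn.
Qed.

Lemma edge_level_hubs x y : x.2 = None -> y.2 = None -> (edge_level x y <= n)%N ->
  exists i b, (x = (inl i, None) /\ y = (inr b, None)) \/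
              (y = (inl i, None) /\ x = (inr b, None)).
Proof.
case: x y => [[i|b] [k|]] [[j|b'] [k'|]] //= _ _; rewrite ?ltnn// => _.
  by exists i, b'; left.
by exists j, b; right.
Qed.

Definition neighbors x (j : nat) : {set theta_vertex n} :=
  [set y | (y != x) && (edge_level x y <= j)%N]%SET.

Lemma card_pole_neighbors b j : (n + n <= #|neighbors (inr b, None) j|)%N.
Proof.
pose f (z : 'I_n + 'I_n) : theta_vertex n :=
  match z with inl i => (inl i, None) | inr k => (inr b, Some k) end.
have f_inj : injective f by move=> [i|k] [i'|k'] //= [->].
rewrite -[X in (X + _)%N]card_ord -[X in (_ + X)%N]card_ord -card_sum.
rewrite -(card_imset _ f_inj); apply: subset_leq_card.
apply/fintype.subsetP => _ /imsetP[z _ ->]; rewrite inE.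
by case: z => [i|k] //=; rewrite xpair_eqE andbF eqxx.
Qed.

Lemma card_mid_neighbors_ge i (j : 'I_n) : i != j ->
  (j.+3 <= #|neighbors (inl i, None) j|)%N.
Proof.
move=> ij; pose f (z : bool + 'I_j.+1) : theta_vertex n :=
  match z with
  | inl b => (inr b, None)
  | inr k => (inl i, Some (widen_ord (ltn_ord j) k))
  end.
have f_inj : injective f.
  by move=> [b|k] [b'|k'] //= [] => [->|/val_inj ->].
have <- : #|{: bool + 'I_j.+1}| = j.+3 by rewrite card_sum card_bool card_ord.
rewrite -(card_imset _ f_inj); apply: subset_leq_card.
apply/fintype.subsetP => _ /imsetP[z _ ->]; rewrite inE.
case: z => [b|k] //=; rewrite xpair_eqE andbF eqxx; case: eqP => [ki|_]; last first.
  by rewrite addn0 -ltnS ltn_ord.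
rewrite addn1 ltn_neqAle -ltnS ltn_ord andbT.
by apply: contra_neq ij => kj; apply: val_inj; rewrite -ki.
Qed.

Lemma card_mid_neighbors_le (i : 'I_n) : (#|neighbors (inl i, None) i| <= i.+2)%N.
Proof.
pose f (z : bool + 'I_i) : theta_vertex n :=
  match z with
  | inl b => (inr b, None)
  | inr k => (inl i, Some (widen_ord (ltnW (ltn_ord i)) k))
  end.
have <- : #|{: bool + 'I_i}| = i.+2 by rewrite card_sum card_bool card_ord.
rewrite -cardsT; apply: leq_trans (leq_imset_card f _).
apply: subset_leq_card; apply/fintype.subsetP => y; rewrite inE => /andP[_].
have ni : (n < i)%N = false by apply/negbTE; rewrite -leqNgt ltnW.
case: y => [[j|b] [k|]] //=; rewrite ?ni//; last first.
  by move=> _; apply/imsetP; exists (inl b).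
case: eqP => [[<-]|]; last by rewrite ni.
move=> ki; have {}ki : (k < i)%N.
  by move: ki; case: eqP => [->|/eqP ki]; rewrite ?addn1 ?ltnn// addn0 ltn_neqAle ki.
by apply/imsetP; exists (inr (Ordinal ki)) => //=; congr (_, Some _); apply: val_inj.
Qed.

End ThetaVertices.

Section ThetaMetric.
Variables (R : realType) (n : nat).
Implicit Types (x y : theta_vertex n).

(** All positive distances are in [[1, 2]], where the triangle inequality is
    automatic and the weights can be chosen freely. *)
Definition theta_dist x y : R :=
  if x == y then 0 else 1 + (edge_level x y)%:R / n.+1%:R.

Definition level_radius (j : nat) : {nonneg R} := (1 + j%:R / n.+1%:R)%:nng.

Lemma theta_dist_le_radius x y j :
  (theta_dist x y <= (level_radius j)%:num) = (x == y) || (edge_level x y <= j)%N.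
Proof.
rewrite /theta_dist; case: eqP => _ /=; first by rewrite addr_ge0// divr_ge0.
by rewrite lerD2l ler_pM2r ?invr_gt0 ?ltr0n// ler_nat.
Qed.

Lemma theta_dist_lt2 x y : x != y -> theta_dist x y < 2 -> (edge_level x y <= n)%N.
Proof.
rewrite /theta_dist => /negPf ->; rewrite (_ : 2 = 1 + 1 :> R)// ltrD2l.
by rewrite ltr_pdivrMr ?ltr0n// mul1r ltr_nat ltnS.
Qed.

Lemma level_radius_lt2 j : (j <= n)%N -> (level_radius j)%:num < 2.
Proof.
by move=> jn; rewrite (_ : 2 = 1 + 1 :> R)//= ltrD2l ltr_pdivrMr ?ltr0n// mul1r ltr_nat.
Qed.

Lemma theta_distC x y : theta_dist x y = theta_dist y x.
Proof. by rewrite /theta_dist eq_sym edge_levelC. Qed.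

Lemma theta_dist_range x y : x != y -> 1 <= theta_dist x y <= 2.
Proof.
rewrite /theta_dist => /negPf ->; rewrite lerDl divr_ge0//=.
rewrite (_ : 2 = 1 + 1 :> R)// lerD2l ler_pdivrMr ?ltr0n// mul1r ler_nat.
exact: edge_level_max.
Qed.

End ThetaMetric.

(** * The degree filtration of the weighted theta graph *)

Lemma mem_degree_simplices (V : finType) (K : complex V) (k : int) (s : {set V}) :
  (s \in degree_simplices K k) =
  (s \in simplices K) && [forall v in s, k - 1 <= (degree K v)%:Z].
Proof.
have [[Kc Ksub Kdeg] Kmax] := degree_simplicesP K k.
apply/idP/andP => [sK|[sK /forall_inP sdeg]].
  split; first exact: (fintype.subsetP Ksub).
  apply/forall_inP => v vs; apply: Kdeg; case: Kc => _; apply; first exact: sK.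
    by rewrite finset.sub1set.
  by rewrite -cards_eq0 cards1.
pose L := [set t in simplices K | [forall v in t, k - 1 <= (degree K v)%:Z]]%SET.
suff /Kmax/fintype.subsetP : degree_ge_subcomplex K k L.
  by apply; rewrite inE sK; exact/forall_inP.
have [K0 Kdown] := complexP K; split.
- split=> [|t t']; first by rewrite inE negb_and K0.
  rewrite !inE => /andP[tK /forall_inP tdeg] t't t'0.
  rewrite (Kdown t)//=; apply/forall_inP => v vt'; apply: tdeg.
  exact: (fintype.subsetP t't).
- by apply/fintype.subsetP => t; rewrite inE => /andP[].
- by move=> v; rewrite inE => /andP[_ /forall_inP]; apply; rewrite inE.
Qed.

Section ThetaFiltration.
Variables (F : fieldType) (R : realType) (n : nat) (V : finType).
Variables (f : V -> theta_vertex n) (g : theta_vertex n -> V).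
Hypotheses (fK : cancel f g) (gK : cancel g f) (n_gt1 : (1 < n)%N).
(* The vertices are transported along [f] because in the Cech case they are
   the points of a finite subset of the line. *)
Variable K : filtration {nonneg R} V.
Hypothesis K_rips : forall r,
  simplices (K r) = rips_simplices (fun x y => theta_dist R (f x) (f y)) r.

Local Notation DF := (degree_filtration K).
Local Notation dist x y := (theta_dist R (f x) (f y)).
Let mid (i : 'I_n) : V := g (inl i, None).
Let pole (b : bool) : V := g (inr b, None).

Let mid_inj : injective mid.
Proof. by move=> i j /(can_inj gK)[]. Qed.
Let pole_inj : injective pole.
Proof. by move=> i j /(can_inj gK)[]. Qed.
Let mid_pole i b : mid i != pole b.
Proof. by rewrite (inj_eq (can_inj gK)). Qed.

Let mem_K r s :
  reflect (s != finset.set0 /\ forall x y, x \in s -> y \in s -> dist x y <= r%:num)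
  (s \in simplices (K r)).
Proof.
rewrite K_rips inE; apply: (iffP andP) => -[s0 sr]; split=> //.
  by move=> x y xs ys; move/forall_inP/(_ x xs)/forall_inP/(_ y ys): sr.
by apply/forall_inP => x xs; apply/forall_inP => y ys; exact: sr.
Qed.

Let mem_DF (p : bidegree R) (s : {set V}) : (s \in simplices (DF p)) =
  (s \in simplices (K p.2)) && [forall v in s, (p.1 : int) - 1 <= (degree (K p.2) v)%:Z].
Proof. exact: mem_degree_simplices. Qed.

Let edge_K r (x y : V) : ([set x; y]%SET \in simplices (K r)) = (dist x y <= r%:num).
Proof.
apply/mem_K/idP => [[_]|xy]; first by apply; rewrite !inE eqxx ?orbT.
have d0 u : dist u u <= r%:num by rewrite /theta_dist eqxx.
split=> [|u v]; first by apply/set0Pn; exists x; rewrite !inE eqxx.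
by rewrite !inE => /orP[]/eqP-> /orP[]/eqP->//; rewrite theta_distC.
Qed.

(* Edges at [v] correspond to neighbors of [v]. *)
Let degree_K j (v : V) : degree (K (level_radius R n j)) v = #|neighbors (f v) j|.
Proof.
have -> : #|neighbors (f v) j| = #|f @^-1: neighbors (f v) j|.
  by rewrite on_card_preimset//; apply: onW_bij; exists g.
have e_inj : {in f @^-1: neighbors (f v) j &, injective (fun u => [set v; u]%SET)}.
  move=> u u'; rewrite !inE => /andP[uv _] /andP[u'v _] /setP/(_ u).
  rewrite !inE eqxx orbT => /esym/orP[/eqP uv'|/eqP//].
  by rewrite uv' eqxx in uv.
rewrite -(card_in_imset e_inj); apply: eq_card => e.
apply/idP/imsetP => [|[u]].
  rewrite inE => /and3P[eK /cards2P[x [y [xy eE]]] ve].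
  have [u [uv {}eE]] : exists u, u != v /\ e = [set v; u]%SET.
    move: ve; rewrite eE !inE => /orP[/eqP->|/eqP->].
      by exists y; rewrite eq_sym.
    by exists x; split=> //; rewrite finset.setUC.
  exists u => //; rewrite !inE (inj_eq (can_inj fK)) uv.
  by move: eK; rewrite eE edge_K theta_dist_le_radius (inj_eq (can_inj fK)) eq_sym (negPf uv).
rewrite !inE (inj_eq (can_inj fK)) => /andP[uv vu] ->.
by rewrite inE edge_K theta_dist_le_radius vu orbT cards2 [v == u]eq_sym uv !inE eqxx.
Qed.

(* Adjacent vertices are on different sides. *)
Let K_card r s : r%:num < 2 -> s \in simplices (K r) -> (#|s| <= 2)%N.
Proof.
move=> r2 /mem_K[_ sr].
have c_inj : {in s &, injective (@side n \o f)}.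
  move=> x y xs ys /=; apply: contra_eq => xy.
  apply/edge_level_side/(@theta_dist_lt2 R).
    by rewrite (inj_eq (can_inj fK)).
  by apply: le_lt_trans r2; exact: sr.
by rewrite -(card_in_imset c_inj) -card_bool max_card.
Qed.

Let DF_dim (p : bidegree R) : p.2%:num < 2 ->
  forall s, s \in simplices (DF p) -> #|s| <> 3.
Proof. by move=> p2 s; rewrite mem_DF => /andP[/(K_card p2) + _] s3; rewrite s3. Qed.

Let DF_edges (p : bidegree R) : p.2%:num < 2 ->
  forall s, s \in simplices (DF p) -> #|s| = 2 ->
  (exists i b, s = strand_edge mid pole i b) \/
  (exists2 y, y \in s &
     forall t, t \in simplices (DF p) -> #|t| = 2 -> y \in t -> t = s).
Proof.
move=> p2.
have edge_level_DF x y : x != y -> [set x; y]%SET \in simplices (DF p) ->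
    (edge_level (f x) (f y) <= n)%N.
  move=> xy; rewrite mem_DF edge_K => /andP[xyp _].
  apply: (@theta_dist_lt2 R); first by rewrite (inj_eq (can_inj fK)).
  exact: le_lt_trans p2.
have leaf x y : x != y -> [set x; y]%SET \in simplices (DF p) -> (f x).2 != None ->
    y = g ((f x).1, None).
  move=> xy /(edge_level_DF _ _ xy); case E: (f x) => [h [k|]] //= + _.
  by move=> /edge_level_leaf <-; rewrite fK.
have leaf_only x y : x != y -> [set x; y]%SET \in simplices (DF p) -> (f x).2 != None ->
    forall t, t \in simplices (DF p) -> #|t| = 2 -> x \in t -> t = [set x; y]%SET.
  move=> xy xyD x2 t tD /eqP/cards2P[u [v [uv tE]]].
  move: tD; rewrite tE => tD; rewrite (leaf _ _ xy xyD x2) !inE => /orP[]/eqP xE.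
    by rewrite -xE in uv tD *; rewrite (leaf _ _ uv tD).
  rewrite -xE eq_sym finset.setUC in uv tD *.
  by rewrite (leaf _ _ uv tD).
move=> s sD /eqP/cards2P[x [y [xy sE]]].
rewrite {s}sE in sD *.
have [x2|x2] := eqVneq (f x).2 None; last first.
  by right; exists x; [rewrite !inE eqxx|exact: leaf_only].
have [y2|y2] := eqVneq (f y).2 None; last first.
  right; exists y; first by rewrite !inE eqxx orbT.
  rewrite finset.setUC in sD *; apply: leaf_only => //.
  by rewrite eq_sym.
have [i [b H]] := edge_level_hubs x2 y2 (edge_level_DF _ _ xy sD).
left; exists i, b; rewrite /strand_edge /mid /pole.
by case: H => -[<- <-]; rewrite !fK// finset.setUC.
Qed.

(* From radius [2] on, all vertices are adjacent, and only the bound on the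
   degrees can remove some of them. *)
Let DF_acyclic (p : bidegree R) : 2 <= p.2%:num ->
  (cycles F 1 (DF p) <= boundaries F 1 (DF p))%VS.
Proof.
move=> p2; pose B := [set v | (p.1 : int) - 1 <= (degree (K p.2) v)%:Z]%SET.
have DFE (s : {set V}) : (s \in simplices (DF p)) = (s != finset.set0) && (s \subset B).
  rewrite mem_DF; have -> : (s \in simplices (K p.2)) = (s != finset.set0).
    apply/mem_K/idP => [[]//|s0]; split=> // x y _ _; apply: le_trans p2.
    have [->|xy] := eqVneq x y; first by rewrite /theta_dist eqxx.
    by have /andP[] := theta_dist_range R (x := f x) (y := f y)
         (contra_neq (@can_inj _ _ _ _ fK x y) xy).
  congr (_ && _); apply/forall_inP/fintype.subsetP => sB v /sB; by rewrite inE.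
have [B0|/set0Pn[v vB]] := eqVneq B finset.set0.
  apply/subvP => c /memv_capP[/mem_chains cD _].
  suff -> : c = 0 by exact: mem0v.
  apply/ffunP => s; rewrite ffunE; apply/eqP; apply: contraT => /cD[].
  by rewrite DFE B0 finset.subset0 => /andP[/negPf->].
pose a := [arg min_(w < v in B) enum_rank w].
have [aB a_min] : a \in B /\ forall b, b \in B -> (enum_rank a <= enum_rank b)%N.
  by rewrite /a; case: arg_minnP.
exact: (full_simplex_acyclic F aB a_min DFE).
Qed.

(* At stage [j] the middle vertices have degree [j + 3], except the [j]-th one,
   which has degree [j + 2]; the degree [(j + 4) - 1] required at the [j]-th
   corner removes just this one among them. *)
Let corner (j : 'I_n) : bidegree R := ((j + 4)%:Z, level_radius R n j).
Let apex : bidegree R := (4%:Z, level_radius R n n).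

Let corner_apex j : (corner j <= apex)%O.
Proof.
apply/andP; split; first by change (4%:Z <= (j + 4)%:Z); rewrite lez_nat leq_addl.
change ((level_radius R n j)%:num <= (level_radius R n n)%:num).
by rewrite /= lerD2l ler_pM2r ?invr_gt0 ?ltr0n// ler_nat ltnW ?ltn_ord.
Qed.

Let strand_edge_corner i j b :
  (strand_edge mid pole i b \in simplices (DF (corner j))) = (i != j).
Proof.
rewrite mem_DF edge_K theta_dist_le_radius !gK/=.
have jE : (j + 4)%:Z - 1 = (j.+3)%:Z by rewrite addn4 intS addrC addKr.
apply/forall_inP/idP => [ij|ij v].
  have := ij (mid i); rewrite !inE eqxx => /(_ isT); rewrite degree_K gK.
  rewrite [_ - _]jE lez_nat; apply: contraTneq => ->; rewrite -ltnNge ltnS.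
  exact: card_mid_neighbors_le.
rewrite [_ - _]jE lez_nat degree_K !inE => /orP[]/eqP->; rewrite gK.
  exact: card_mid_neighbors_ge.
apply: leq_trans (card_pole_neighbors _ _ _).
by apply: (@leq_trans n.+2); rewrite ?ltnS ?ltn_ord// -addn2 leq_add2l.
Qed.

(* The apex is above a corner that retains the vertex [i]. *)
Let strand_edge_apex i b : strand_edge mid pole i b \in simplices (DF apex).
Proof.
have [j ij] : exists j, i != j.
  have n_gt0 := ltnW n_gt1.
  have [->|] := eqVneq i (Ordinal n_gt0); last by exists (Ordinal n_gt0).
  by exists (Ordinal n_gt1).
apply: (fintype.subsetP (filt_mono DF (corner_apex j))).
by rewrite strand_edge_corner.
Qed.

Let Q (A : {set 'I_n}) : set (bidegree R) :=
  [set p | p.2%:num < 2 /\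
     forall i b, i \in A -> strand_edge mid pole i b \in simplices (DF p)]%classic.

Let Q_convex A : poset_convex (Q A).
Proof.
move=> p q r [_ Ap] [q2 _] /andP[pr /andP[_ rq]]; split.
  exact: le_lt_trans q2.
by move=> i b iA; apply: (fintype.subsetP (filt_mono DF pr)); exact: Ap.
Qed.

Let sgn (A : {set 'I_n}) : int := if (1 < #|A|)%N then (-1) ^+ #|A| else 0.

Let rank_sum (I : poset_interval (bidegree R)) :
  (generalized_rank (homology_module F 1 DF) I)%:Z =
  \sum_A sgn A * (`[< (interval_set I `<=` Q A)%classic >])%:R.
Proof.
have [[p [Ip p2]]|I2] := pselect (exists p, interval_set I p /\ 2 <= p.2%:num).
  rewrite (generalized_rank_eq0 (M := homology_module F 1 DF) Ip
    (homology_eq0 (DF_acyclic p2))).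
  rewrite big1// => A _; case: asboolP => [IQ|_]; last by rewrite mulr0.
  by have [+ _] := IQ p Ip; rewrite ltNge p2.
have {}I2 p : interval_set I p -> p.2%:num < 2.
  by move=> Ip; rewrite ltNge; apply/negP => p2; apply: I2; exists p.
rewrite (theta_generalized_rank F mid_inj pole_inj mid_pole (K := DF) (I := I)); first last.
- by move=> p Ip; apply: DF_edges; exact: I2.
- by move=> p Ip; apply: DF_dim; exact: I2.
set S := full_strands _ _ _; rewrite -sum_large_subsets_sign big_mkcondr/= big_mkcond/=.
apply: eq_bigr => A _; rewrite /sgn; case: ifP => _; last by rewrite mul0r.
have -> : `[< (interval_set I `<=` Q A)%classic >] = (A \subset S).
  apply/asboolP/fintype.subsetP => [IQ i iA|AS p Ip].
    by rewrite !inE; apply/andP; split; apply/asboolP => p Ip; have [_] := IQ p Ip; apply.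
  split=> [|i b /AS]; first exact: I2.
  by rewrite !inE => /andP[/asboolP i0 /asboolP i1]; case: b; [exact: i1|exact: i0].
by case: ifP => _; rewrite ?mulr1 ?mulr0.
Qed.

(** The bidegrees comparable to the apex tell the sets [Q A] apart, since the
    [i]-th corner is in [Q A] exactly when [i] is not in [A]. *)
Lemma theta_gpd : exists dgm : poset_interval (bidegree R) -> int,
  is_gpd (homology_module F 1 DF) dgm /\
  forall x : R, gpd_size_le dgm x -> (2 ^ n - n.+1)%:R <= x.
Proof.
exists (component_gpd sgn Q); split.
  by apply: component_gpdP => //; exact: rank_sum.
move=> x /(component_gpd_size Q_convex (p0 := apex)) sz.
have := card_large_subsets 'I_n; rewrite card_ord => le_n.
apply: (@le_trans _ _ (#|[set A | sgn A != 0]%SET|%:R)).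
  rewrite ler_nat; apply: (leq_trans le_n); apply: subset_leq_card.
  by apply/fintype.subsetP => A; rewrite !inE /sgn => ->; rewrite signr_eq0.
apply: sz => [A|A B AB BA].
  by split; [exact: level_radius_lt2|move=> i b _; exact: strand_edge_apex].
have Q_corner C i : Q C (corner i) <-> i \notin C.
  split=> [[_ Ci]|iC].
    by apply/negP => /(Ci _ false); rewrite strand_edge_corner eqxx.
  split; first by apply: level_radius_lt2; exact: ltnW.
  by move=> j b jC; rewrite strand_edge_corner; apply: contraNneq iC => <-.
have cmp i : (corner i >=< apex)%O by rewrite /Order.comparable corner_apex.
apply/setP => i; apply/idP/idP; apply: contraTT => /Q_corner.
  by move=> /(BA _ (cmp i))/Q_corner.
by move=> /(AB _ (cmp i))/Q_corner.
Qed.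

End ThetaFiltration.

(** * Rips complexes as Cech complexes *)

Section MetricRange.
Variables (R : realType) (T : Type) (dist : T -> T -> R).
Hypotheses (dist0 : forall x, dist x x = 0)
  (distC : forall x y, dist x y = dist y x)
  (dist_range : forall x y, x <> y -> 1 <= dist x y <= 2).

(** A distance is at most [2], and a sum of two positive ones at least [2]. *)
Lemma metric_of_range : is_metric dist.
Proof.
have ge0 x y : 0 <= dist x y.
  have [->|/dist_range/andP[h _]] := pselect (x = y); first by rewrite dist0.
  exact: le_trans h.
split=> // [x y|x y z].
  split=> [xy0|->//]; apply: contrapT => /dist_range/andP[+ _].
  by rewrite xy0 ler10.
have [->|/dist_range/andP[xy _]] := pselect (x = y); first by rewrite dist0 add0r.
have [->|/dist_range/andP[yz _]] := pselect (y = z); first by rewrite dist0 addr0.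
have [->|/dist_range/andP[_ xz]] := pselect (x = z); first by rewrite dist0 addr_ge0.
by apply: (le_trans xz); rewrite (_ : 2 = 1 + 1 :> R)// lerD.
Qed.

End MetricRange.

Section CechRealization.
Variables (R : realType) (T : finType) (dist : T -> T -> R).
Hypotheses (dist0 : forall x, dist x x = 0)
  (dist_range : forall x y, x != y -> 1 <= dist x y <= 2).

Local Notation point := (T + {set T})%type.

(* Any injection of the points and of the witnesses in the line would do: the
   ambient metric ignores the coordinates. *)
Let place (y : point) : 'rV[R]_1 := const_mx (enum_rank y)%:R.

Let place_inj : injective place.
Proof.
move=> y z /matrixP/(_ 0 0); rewrite !mxE => /eqP; rewrite eqr_nat => /eqP.
by move=> /val_inj/enum_rank_inj.
Qed.

Let label (u : 'rV[R]_1) : option point := [pick y | place y == u].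

Let label_place y : label (place y) = Some y.
Proof.
rewrite /label; case: pickP => [z /eqP/place_inj -> //|/(_ y)].
by rewrite eqxx.
Qed.

Let diam (s : {set T}) : R :=
  \big[Order.max/1]_(z : T * T | (z.1 \in s) && (z.2 \in s)) dist z.1 z.2.

Let diam_le (s : {set T}) r :
  reflect (1 <= r /\ forall x y, x \in s -> y \in s -> dist x y <= r)
  (diam s <= r).
Proof.
apply: (iffP (bigmax_leP _ _ _ _)) => -[r1 sr]; split=> //.
  by move=> x y xs ys; apply: (sr (x, y)); rewrite /= xs.
by move=> [x y] /= /andP[]; exact: sr.
Qed.

Let dist_le2 x y : dist x y <= 2.
Proof. by have [->|/dist_range/andP[]//] := eqVneq x y; rewrite dist0. Qed.

Let diam_range (s : {set T}) : 1 <= diam s <= 2.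
Proof.
apply/andP; split; last by apply/diam_le; rewrite ler1n.
by have /diam_le[] := lexx (diam s).
Qed.

(* The ambient distance between distinct points with labels [y] and [z].
   Points of the line without label are far from everything. *)
Let gap (y z : option point) : R :=
  match y, z with
  | Some (inl x), Some (inr s) | Some (inr s), Some (inl x) =>
    if x \in s then diam s else 2
  | _, _ => 2
  end.

Let gap_range y z : 1 <= gap y z <= 2.
Proof.
have two : (1 : R) <= 2 <= (2 : R) by apply/andP; split; rewrite ?ler1n.
by case: y z => [[x|s]|] [[x'|s']|] //=; case: ifP.
Qed.

Let line_dist (u v : 'rV[R]_1) : R := if u == v then 0 else gap (label u) (label v).

Let line_dist_metric : is_metric line_dist.
Proof.
apply: metric_of_range => [x|x y|x y /eqP/negPf xy]; rewrite /line_dist.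
- by rewrite eqxx.
- by rewrite eq_sym; case: eqP => // _; case: (label x) (label y) => [[?|?]|] [[?|?]|].
- by rewrite xy; exact: gap_range.
Qed.

Let X : {fset 'rV[R]_1} := [fset place (inl x) | x in T]%fset.

Let X_place x : place (inl x) \in X.
Proof. by apply/imfsetP; exists x. Qed.

Let to_X (x : T) : X := [` X_place x]%fset.

Let X_ex (u : X) : exists x, place (inl x) = val u.
Proof. by have /imfsetP[x _ ->] := valP u; exists x. Qed.

Let of_X (u : X) : T := projT1 (cid (X_ex u)).

Let place_of_X u : place (inl (of_X u)) = val u.
Proof. exact: projT2 (cid (X_ex u)). Qed.

Let of_XK : cancel of_X to_X.
Proof. by move=> u; apply: val_inj; rewrite /= place_of_X. Qed.

Let to_XK : cancel to_X of_X.
Proof. by move=> x; have /place_inj[] := place_of_X (to_X x). Qed.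

Let cech_rips r :
  cech_simplices line_dist X r = rips_simplices (fun u v => dist (of_X u) (of_X v)) r.
Proof.
apply/setP => s; rewrite !inE; have [//|/set0Pn[u0 u0s]] := eqVneq s finset.set0.
apply/asboolP/forall_inP => [[z sz] u us|sr].
  apply/forall_inP => v vs.
  have [r2|r2] := leP 2 r%:num; first exact: le_trans r2.
  have u_z w : w \in s -> z = val w \/
      exists2 t, z = place (inr t) & (of_X w \in t) && (diam t <= r%:num).
    move=> ws; have := sz w ws; rewrite /dist_closed_ball /= /line_dist.
    case: eqP => [<-|_]; first by left.
    rewrite -place_of_X label_place /label; case: pickP => [[y|t] /eqP zE|_] /=.
    - by rewrite leNgt r2.
    - by case: ifP => wt; [move=> tr; right; exists t; rewrite ?wt|rewrite leNgt r2].
    - by rewrite leNgt r2.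
  have [zu|[t zt /andP[ut tr]]] := u_z u us.
    have [zv|[t + _]] := u_z v vs; last by rewrite zu -place_of_X => /place_inj.
    have -> : u = v by apply: val_inj; rewrite -zu -zv.
    by rewrite dist0.
  have [|[t' zt' /andP[vt' tr']]] := u_z v vs; first by rewrite zt -place_of_X => /place_inj.
  move: zt'; rewrite zt => /place_inj[tt']; rewrite -tt' in vt'.
  by have /diam_le[_] := tr; apply.
have {}sr u v : u \in s -> v \in s -> dist (of_X u) (of_X v) <= r%:num.
  by move=> us vs; move/forall_inP: (sr u us); apply.
have [r1|r1] := leP 1 r%:num.
  exists (place (inr (of_X @: s)%SET)) => u us /=.
  rewrite /dist_closed_ball /= /line_dist -place_of_X.
  case: eqP => [/place_inj//|_]; rewrite !label_place /= imset_f//.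
  apply/diam_le; split=> // _ _ /imsetP[v vs ->] /imsetP[w ws ->]; exact: sr.
exists (val u0) => u us; rewrite /dist_closed_ball /= /line_dist.
have -> : u = u0.
  apply: (can_inj of_XK); apply/eqP; apply: contraT => /dist_range/andP[+ _].
  by rewrite leNgt (le_lt_trans (sr _ _ us u0s)).
by rewrite eqxx.
Qed.

(** At a radius [r < 2] balls around different points of the space meet only in
    witnesses, and the witness of a set [t] is in the balls around all points
    of [s] exactly when [s] is included in [t] and [t] has diameter at most
    [r].  For [r >= 2] both complexes are full. *)
Lemma rips_as_cech : exists (ldist : 'rV[R]_1 -> 'rV[R]_1 -> R) (Y : {fset 'rV[R]_1})
    (f : Y -> T) (g : T -> Y),
  [/\ is_metric ldist, cancel f g, cancel g f &
      forall r, cech_simplices ldist Y r = rips_simplices (fun u v => dist (f u) (f v)) r].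
Proof. by exists line_dist, X, of_X, to_X. Qed.

End CechRealization.

(** * Growth and conclusion *)

(** With [n = 2 ^ (2 t)] the polynomial is at most [2 ^ (6 t k + c)], and the
    exponent is linear in [t], while [n] exceeds [t ^ 2]. *)
Lemma exp_outgrows_poly (k c : nat) :
  exists2 n, (1 < n)%N & (2 ^ c * ((n + 2) * n.+1) ^ k < 2 ^ n - n.+1)%N.
Proof.
pose t := (6 * k + c + 1)%N; pose n := (2 ^ (2 * t))%N.
have n_ge : ((t + 1) ^ 2 <= n)%N.
  by rewrite /n mulnC expnM leq_exp2r// addn1 ltn_expl.
exists n; first by rewrite /t in n_ge; nia.
have n4 : (4 <= n)%N by rewrite /t in n_ge; nia.
have lin m : (m.+3.+1 <= 2 ^ m.+2)%N by elim: m => // m IH; rewrite expnS; lia.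
have half : (2 ^ n.-1 <= 2 ^ n - n.+1)%N.
  have := lin (n - 3)%N; have -> : (n - 3).+2 = n.-1 by lia.
  have := expnS 2 n.-1; rewrite prednK; last by lia.
  by lia.
apply: leq_trans half.
apply: (@leq_ltn_trans (2 ^ c * (n ^ 3) ^ k)%N).
  rewrite leq_mul2l; apply/orP; right.
  have [->|k0] := posnP k; first by rewrite !expn0.
  rewrite leq_exp2r// 2!expnS expn1; move: (n) n4 => q q4; nia.
rewrite -expnM {1}/n -expnM -expnD ltn_exp2l//.
have tt : (t * t = 6 * k * t + c * t + t)%N by rewrite {1}/t; ring.
have ct : (c < t)%N by rewrite /t; lia.
rewrite expnS expn1 in n_ge; move: (n) n_ge n4 => q; clearbody t; nia.
Qed.

Lemma card_theta_vertex n : #|theta_vertex n| = ((n + 2) * n.+1)%N.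
Proof. by rewrite card_prod card_sum card_ord card_bool card_option card_ord. Qed.

Lemma theta_outgrows (R : realType) (k : nat) (C : R) : 0 < C ->
  exists2 n, (1 < n)%N & C * #|theta_vertex n|%:R ^+ k < (2 ^ n - n.+1)%:R.
Proof.
move=> C0; have [n n_gt1 lt_n] := exp_outgrows_poly k (Num.bound C).
exists n => //; apply: le_lt_trans (_ : (2 ^ Num.bound C * #|theta_vertex n| ^ k)%:R < _).
  rewrite -natrX natrM; apply: ler_wpM2r; first exact: ler0n.
  apply: (le_trans (ltW (archi_boundP (ltW C0)))).
  by rewrite ler_nat ltnW// ltn_expl.
by rewrite ltr_nat card_theta_vertex.
Qed.

Lemma theta_dist0 (R : realType) n (x : theta_vertex n) : theta_dist R x x = 0.
Proof. by rewrite /theta_dist eqxx. Qed.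

Theorem theorem21 (F : fieldType) (R : realType) :
  ~ (exists (k : nat) (C : R), 0 < C /\
       forall (X : finType) (dist : X -> X -> R), is_metric dist ->
       forall dgm : poset_interval (bidegree R) -> int,
         is_gpd (homology_module F 1 (degree_rips dist)) dgm ->
         gpd_size_le dgm (C * #|X|%:R ^+ k)) /\
  ~ (exists (k : nat) (C : R), 0 < C /\
       forall (D : nat) (dist : 'rV[R]_D -> 'rV[R]_D -> R), is_metric dist ->
       forall (X : {fset 'rV[R]_D}) (dgm : poset_interval (bidegree R) -> int),
         is_gpd (homology_module F 1 (degree_cech dist X)) dgm ->
         gpd_size_le dgm (C * #|` X|%:R ^+ k)).
Proof.
split=> -[k [C [C_gt0 bound]]];
  have [n n_gt1 outgrow] := @theta_outgrows R k C C_gt0.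
  have dist_metric : is_metric (@theta_dist R n).
    apply: metric_of_range => [x|x y|x y /eqP xy]; first exact: theta_dist0.
      exact: theta_distC.
    exact: theta_dist_range.
  have [dgm [dgmP dgm_size]] := @theta_gpd F R n (theta_vertex n) id id
    (fun=> erefl) (fun=> erefl) n_gt1 (rips (@theta_dist R n)) (fun=> erefl).
  have /dgm_size := bound _ _ dist_metric dgm dgmP.
  by rewrite leNgt outgrow.
have [dist [X [f [g [dist_metric fK gK cech_rips]]]]] :=
  rips_as_cech (@theta_dist0 R n) (@theta_dist_range R n).
have [dgm [dgmP dgm_size]] := @theta_gpd F R n _ f g fK gK n_gt1 (cech dist X) cech_rips.
have /dgm_size := bound _ _ dist_metric X dgm dgmP.
have -> : #|` X| = #|theta_vertex n|.
  by rewrite cardfE; apply: bij_eq_card; exists g.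
by rewrite leNgt outgrow.
Qed.
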